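(* Let $f\colon H'\to H$ be a perfect bialgebra map between finite-dimensional Hopf algebras over $\Bbbk$, and let $F_f\colon\mathsf{Rep}(H)\to\mathsf{Rep}(H')$ be the induced restriction-of-scalars tensor functor. (i) $F_f$ is Frobenius $\iff$ $\chi_f=\varepsilon_{H'}$ $\iff$ $\alpha_H\circ f=\alpha_{H'}$. (ii) $F_f$ is $\otimes$-Frobenius $\iff$ ($\chi_f=\varepsilon_{H'}$ and $f(g_{H'})=g_H$) $\iff$ ($\alpha_H\circ f=\alpha_{H'}$ and $f(g_{H'})=g_H$).
   Context: $\Bbbk$ is an algebraically closed field; $\mathsf{Rep}(H)$ is the finite tensor category of finite-dimensional left $H$-modules. $F_f$ sends $X$ to $X$ with $H'$-action $h'\cdot x=f(h')x$. The map $f$ is perfect if $F_f$ is perfect, i.e. the right adjoint of $F_f$ is exact; equivalently, $H$ is projective as an $H'$-module via $f$. For a finite-dimensional Hopf algebra $H$ with antipode $S_H$ and counit $\varepsilon_H$ (Sweedler notation $\Delta(h)=h_1\otimes h_2$): let $\Lambda\ne0$ be a left integral ($h\Lambda=\varepsilon_H(h)\Lambda$); the modular function $\alpha_H\colon H\to\Bbbk$ is the algebra map with $\Lambda h=\alpha_H(h)\Lambda$. Let $\lambda\colon H\to\Bbbk$ be a nonzero right cointegral ($\lambda(h_1)h_2=\lambda(h)1_H$); the distinguished grouplike element $g_H\in H$ is the element with $h_1\lambda(h_2)=\lambda(h)g_H$ for all $h$. The relative modular function of $f$ is $\chi_f\colon H'\to\Bbbk$, $\chi_f(h')=\alpha_H\bigl(S_H(f(h'_1))\bigr)\,\alpha_{H'}(h'_2)$.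 A functor $F$ with left and right adjoints $F^{\mathrm{la}},F^{\mathrm{ra}}$ is Frobenius if $F^{\mathrm{la}}\cong F^{\mathrm{ra}}$ as $\Bbbk$-linear functors. A tensor functor $F\colon\mathcal C\to\mathcal D$ is $\otimes$-Frobenius if $F^{\mathrm{la}}\cong F^{\mathrm{ra}}$ as $\mathcal C$-bimodule functors ${}_F\mathcal D_F\to\mathcal C$, where ${}_F\mathcal D_F$ is $\mathcal D$ with the $\mathcal C$-bimodule action $F(c)\otimes d\otimes F(c')$ and the adjoints carry the bimodule structures induced from that of $F\colon\mathcal C\to{}_F\mathcal D_F$. *)

(* Defs.v *)
From HB Require Import structures.
From mathcomp Require Import all_boot all_algebra all_field.
From mathcomp Require Import boolp.

Set Implicit Arguments.
Unset Strict Implicit.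
Unset Printing Implicit Defensive.

Import GRing.Theory.
Local Open Scope ring_scope.

Section Tensor.

Variable k : fieldType.
Implicit Types U V W X Y : vectType k.

(* U (x) V as the space of coordinate matrices with respect to the bases
   [vbasis fullv] of U and V; [tlift b], for b bilinear, is the linear map with
   [tlift b (pure u v) = b u v] (see [tlift_pure]). *)
Definition tensor U V : vectType k := 'M[k]_(\dim {:U}, \dim {:V}).

Definition pure U V (u : U) (v : V) : tensor U V :=
  \matrix_(i, j) (coord (vbasis fullv) i u * coord (vbasis fullv) j v).

Definition tlift U V W (b : U -> V -> W) : 'Hom(tensor U V, W) :=
  linfun (fun M : 'M[k]_(\dim {:U}, \dim {:V}) =>
            \sum_i \sum_j M i j *: b (vbasis fullv)`_i (vbasis fullv)`_j).

Definition bilin U V W (b : U -> V -> W) : Prop :=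
  (forall v, linear (b^~ v)) /\ (forall u, linear (b u)).

Definition tmap U U' V V' (f : 'Hom(U, U')) (g : 'Hom(V, V')) :
  'Hom(tensor U V, tensor U' V') := tlift (fun u v => pure (f u) (g v)).

Definition tassoc U V W :
  'Hom(tensor (tensor U V) W, tensor U (tensor V W)) :=
  tlift (fun t w => tlift (fun u v => pure u (pure v w)) t).

Definition tassocV U V W :
  'Hom(tensor U (tensor V W), tensor (tensor U V) W) :=
  tlift (fun u t => tlift (fun v w => pure (pure u v) w) t).

Fact tlift_subproof U V W (b : U -> V -> W) :
  linear (fun M : 'M[k]_(\dim {:U}, \dim {:V}) =>
            \sum_i \sum_j M i j *: b (vbasis fullv)`_i (vbasis fullv)`_j).
Proof.
move=> a M N; rewrite scaler_sumr -big_split; apply: eq_bigr => i _ /=.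
rewrite scaler_sumr -big_split; apply: eq_bigr => j _ /=.
by rewrite !mxE scalerDl scalerA.
Qed.

Lemma linfunP U V (f : U -> V) : linear f -> linfun f =1 f.
Proof.
move=> fl; pose L := GRing.isLinear.Build _ _ _ _ _ fl.
by pose F : {linear U -> V} := HB.pack f L; apply: (lfunE F).
Qed.

Lemma tliftE U V W (b : U -> V -> W) (M : 'M[k]_(\dim {:U}, \dim {:V})) :
  tlift b M = \sum_i \sum_j M i j *: b (vbasis fullv)`_i (vbasis fullv)`_j.
Proof.
exact: (linfunP (tlift_subproof b)).
Qed.

Lemma tlift_pure U V W (b : U -> V -> W) u v :
  bilin b -> tlift b (pure u v) = b u v.
Proof.
case=> bl br; rewrite tliftE.
have bZ w c x y : b (c *: x + y) w = c *: b x w + b y w by exact: bl.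
have bZ' w c x y : b w (c *: x + y) = c *: b w x + b w y by exact: br.
have b0 w : b 0 w = 0.
  by have := bZ w (-1) 0 0; rewrite !scaleN1r !addNr.
have b0' w : b w 0 = 0.
  by have := bZ' w (-1) 0 0; rewrite !scaleN1r !addNr.
have bs (I : Type) (r : seq I) (c : I -> k) (x : I -> U) w :
    b (\sum_(i <- r) c i *: x i) w = \sum_(i <- r) c i *: b (x i) w.
  by elim: r => [|i r IH]; rewrite ?big_nil // !big_cons bZ IH.
have bs' (I : Type) (r : seq I) (c : I -> k) (x : I -> V) w :
    b w (\sum_(i <- r) c i *: x i) = \sum_(i <- r) c i *: b w (x i).
  by elim: r => [|i r IH]; rewrite ?big_nil // !big_cons bZ' IH.
rewrite [in RHS](coord_vbasis (memvf u)) bs; apply: eq_bigr => i _.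
rewrite [in RHS](coord_vbasis (memvf v)) bs' scaler_sumr; apply: eq_bigr => j _.
by rewrite mxE scalerA.
Qed.

Lemma tensor_ext U V W (f g : 'Hom(tensor U V, W)) :
  (forall u v, f (pure u v) = g (pure u v)) -> f = g.
Proof.
move=> fg; apply/lfunP => M.
have -> : M = \sum_i \sum_j (M : 'M[k]_(\dim {:U}, \dim {:V})) i j *:
    pure (vbasis fullv)`_i (vbasis fullv)`_j :> tensor U V.
  rewrite [LHS](@matrix_sum_delta k _ _ M).
  apply: eq_bigr => i _; apply: eq_bigr => j _; congr (_ *: _).
  apply/matrixP => a b; rewrite !mxE !coord_free ?(basis_free (vbasisP _)) //.
  by rewrite -natrM mulnb [i == a]eq_sym [j == b]eq_sym.
rewrite !linear_sum; apply: eq_bigr => i _.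
rewrite !linear_sum; apply: eq_bigr => j _.
by rewrite !linearZ /= fg.
Qed.

Lemma tlift_lin U V W X (b : U -> V -> W) (g : 'Hom(W, X)) x :
  g (tlift b x) = tlift (fun u v => g (b u v)) x.
Proof.
rewrite !tliftE linear_sum; apply: eq_bigr => i _.
by rewrite linear_sum; apply: eq_bigr => j _; rewrite linearZ.
Qed.

Lemma tlift_app U V W X (b : U -> V -> 'Hom(W, X)) x w :
  tlift b x w = tlift (fun u v => b u v w) x.
Proof.
rewrite !tliftE sum_lfunE; apply: eq_bigr => i _.
rewrite sum_lfunE; apply: eq_bigr => j _.
by rewrite scale_lfunE.
Qed.

Lemma pure_bilin U V : bilin (@pure U V).
Proof.
split=> [v a x y|u a x y]; apply/matrixP => i j; rewrite !mxE linearP.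
  by rewrite mulrDl mulrA.
by rewrite mulrDr mulrCA.
Qed.

Lemma pureDl U V a (x y : U) (v : V) :
  pure (a *: x + y) v = a *: pure x v + pure y v.
Proof. exact: (proj1 (@pure_bilin U V)). Qed.

Lemma pureDr U V a (x : U) (v w : V) :
  pure x (a *: v + w) = a *: pure x v + pure x w.
Proof. exact: (proj2 (@pure_bilin U V)). Qed.

Lemma tliftDl U V W a (b c : U -> V -> W) x :
  tlift (fun u v => a *: b u v + c u v) x = a *: tlift b x + tlift c x.
Proof.
rewrite !tliftE scaler_sumr -big_split; apply: eq_bigr => i _ /=.
rewrite scaler_sumr -big_split; apply: eq_bigr => j _ /=.
by rewrite scalerDr !scalerA mulrC.
Qed.

Lemma eq_tlift U V W (b c : U -> V -> W) : b =2 c -> tlift b = tlift c.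
Proof.
move=> bc; apply/lfunP => x; rewrite !tliftE.
by apply: eq_bigr => i _; apply: eq_bigr => j _; rewrite bc.
Qed.

Lemma tmap_pure U U' V V' (f : 'Hom(U, U')) (g : 'Hom(V, V')) u v :
  tmap f g (pure u v) = pure (f u) (g v).
Proof.
rewrite /tmap tlift_pure //; split=> [w a x y|w a x y] /=.
  by rewrite linearP pureDl.
by rewrite linearP pureDr.
Qed.

Lemma tmapDl U U' V V' a (f f' : 'Hom(U, U')) (g : 'Hom(V, V')) :
  tmap (a *: f + f') g = a *: tmap f g + tmap f' g.
Proof.
apply: tensor_ext => u v; rewrite add_lfunE scale_lfunE !tmap_pure.
by rewrite add_lfunE scale_lfunE pureDl.
Qed.

Lemma tmapDr U U' V V' a (f : 'Hom(U, U')) (g g' : 'Hom(V, V')) :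
  tmap f (a *: g + g') = a *: tmap f g + tmap f g'.
Proof.
apply: tensor_ext => u v; rewrite add_lfunE scale_lfunE !tmap_pure.
by rewrite add_lfunE scale_lfunE pureDr.
Qed.

Lemma tassoc_pure U V W (u : U) (v : V) (w : W) :
  tassoc U V W (pure (pure u v) w) = pure u (pure v w).
Proof.
have bi w' : bilin (fun (u : U) (v : V) => pure u (pure v w')).
  by split=> [? a x y|? a x y] /=; rewrite ?pureDl ?pureDr.
rewrite /tassoc tlift_pure ?tlift_pure //.
split=> [? a x y|t a x y] /=; first by rewrite linearP.
rewrite -tliftDl; congr (fun_of_lfun _ _).
by apply: eq_tlift => u' v' /=; rewrite pureDr pureDr.
Qed.

Lemma tassocV_pure U V W (u : U) (v : V) (w : W) :
  tassocV U V W (pure u (pure v w)) = pure (pure u v) w.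
Proof.
have bi u' : bilin (fun (v : V) (w : W) => pure (pure u' v) w).
  by split=> [? a x y|? a x y] /=; rewrite ?pureDr ?pureDl.
rewrite /tassocV tlift_pure ?tlift_pure //.
split=> [t a x y|? a x y] /=; last by rewrite linearP.
rewrite -tliftDl; congr (fun_of_lfun _ _).
by apply: eq_tlift => u' v' /=; rewrite pureDl pureDl.
Qed.

Lemma tensor3_ext U V W X (f g : 'Hom(tensor (tensor U V) W, X)) :
  (forall u v w, f (pure (pure u v) w) = g (pure (pure u v) w)) -> f = g.
Proof.
move=> fg; apply: tensor_ext => t w.
have hl (h : 'Hom(_, X)) : linear (fun t : tensor U V => h (pure t w)).
  by move=> a x y; rewrite pureDl linearP.
rewrite -(linfunP (hl f)) -(linfunP (hl g)); congr (fun_of_lfun _ t).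
by apply: tensor_ext => u v; rewrite !(linfunP (hl _)) fg.
Qed.

Lemma tensor4_ext U V W X Y
    (f g : 'Hom(tensor (tensor (tensor U V) W) X, Y)) :
  (forall u v w x, f (pure (pure (pure u v) w) x) =
                   g (pure (pure (pure u v) w) x)) -> f = g.
Proof.
move=> fg; apply: tensor_ext => t x.
have hl (h : 'Hom(tensor (tensor (tensor U V) W) X, Y)) :
    linear (fun t : tensor (tensor U V) W => h (pure t x)).
  by move=> a y z; rewrite pureDl linearP.
rewrite -(linfunP (hl f)) -(linfunP (hl g)); congr (fun_of_lfun _ t).
by apply: tensor3_ext => u v w; rewrite !(linfunP (hl _)) fg.
Qed.

Lemma tensor3r_ext U V W X (f g : 'Hom(tensor U (tensor V W), X)) :
  (forall u v w, f (pure u (pure v w)) = g (pure u (pure v w))) -> f = g.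
Proof.
move=> fg; apply: tensor_ext => u t.
have hl (h : 'Hom(_, X)) : linear (fun t : tensor V W => h (pure u t)).
  by move=> a x y; rewrite pureDr linearP.
rewrite -(linfunP (hl f)) -(linfunP (hl g)); congr (fun_of_lfun _ t).
by apply: tensor_ext => v w; rewrite !(linfunP (hl _)) fg.
Qed.

Lemma tassocK U V W : cancel (tassoc U V W) (tassocV U V W).
Proof.
move=> t; rewrite -comp_lfunE -[RHS]id_lfunE; congr (fun_of_lfun _ t).
by apply: tensor3_ext => u v w; rewrite comp_lfunE tassoc_pure tassocV_pure id_lfunE.
Qed.

Lemma tassocVK U V W : cancel (tassocV U V W) (tassoc U V W).
Proof.
move=> t; rewrite -comp_lfunE -[RHS]id_lfunE; congr (fun_of_lfun _ t).
by apply: tensor3r_ext => u v w; rewrite comp_lfunE tassocV_pure tassoc_pure id_lfunE.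
Qed.

End Tensor.

(* Sweedler's sum of E(h_1, h_2), for E bilinear, is written
   [tlift (fun h1 h2 => E) (comul h)]. *)
Record hopf (k : fieldType) := Hopf {
  hopf_alg :> falgType k;
  comul : 'Hom(hopf_alg, tensor hopf_alg hopf_alg);
  counit : {lrmorphism hopf_alg -> k^o};
  antipode : 'End(hopf_alg);
  comul1 : comul 1 = pure 1 1;
  comulM : forall a b : hopf_alg,
    comul (a * b) =
    tlift (fun a1 a2 => tlift (fun b1 b2 => pure (a1 * b1) (a2 * b2))
                          (comul b)) (comul a);
  comulA : forall a, tassoc hopf_alg hopf_alg hopf_alg
      (tmap comul \1%VF (comul a)) = tmap \1%VF comul (comul a);
  counitl : forall a, tlift (fun a1 a2 => (counit a1 : k) *: a2) (comul a) = a;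
  counitr : forall a, tlift (fun a1 a2 => (counit a2 : k) *: a1) (comul a) = a;
  antipodel : forall a, tlift (fun a1 a2 => antipode a1 * a2) (comul a) =
      (counit a : k)%:A;
  antipoder : forall a, tlift (fun a1 a2 => a1 * antipode a2) (comul a) =
      (counit a : k)%:A
}.
Arguments comul {k} h : rename.
Arguments counit {k} h : rename.
Arguments antipode {k} h : rename.

Record bialg_map (k : fieldType) (H' H : hopf k) := BialgMap {
  bialg_fun :> {lrmorphism H' -> H};
  bialg_comul : forall a, comul H (bialg_fun a) =
    tlift (fun a1 a2 => pure (bialg_fun a1) (bialg_fun a2)) (comul H' a);
  bialg_counit : forall a, counit H (bialg_fun a) = counit H' a
}.

Section Integrals.

Variables (k : fieldType) (H : hopf k).

Definition left_integral (L : H) : Prop :=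
  forall h : H, h * L = (counit H h : k) *: L.

Definition right_cointegral (lam : {linear H -> k^o}) : Prop :=
  forall h : H,
    tlift (fun h1 h2 => (lam h1 : k) *: h2) (comul H h) = (lam h : k)%:A.

Definition modular_function (alpha : {lrmorphism H -> k^o}) : Prop :=
  exists L : H, [/\ L != 0, left_integral L &
    forall h : H, L * h = (alpha h : k) *: L].

Definition distinguished_grouplike (g : H) : Prop :=
  exists lam : {linear H -> k^o},
    [/\ exists h, lam h != 0, right_cointegral lam &
      forall h : H,
        tlift (fun h1 h2 => (lam h2 : k) *: h1) (comul H h) =
        (lam h : k) *: g].

End Integrals.

Definition rel_modular (k : fieldType) (H' H : hopf k) (f : bialg_map H' H)
    (alphaH : {lrmorphism H -> k^o}) (alphaH' : {lrmorphism H' -> k^o})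
    (h : H') : k :=
  tlift (fun h1 h2 : H' =>
           (alphaH (antipode H (f h1)) : k) * (alphaH' h2 : k) : k^o)
        (comul H' h).

Section Categories.

Variable k : fieldType.

Record category := Category {
  obj :> Type;
  hom : obj -> obj -> lmodType k;
  idm : forall X, hom X X;
  comp : forall X Y Z, hom Y Z -> hom X Y -> hom X Z;
  compA : forall X Y Z W (h : hom Z W) (g : hom Y Z) (f : hom X Y),
    comp h (comp g f) = comp (comp h g) f;
  comp1m : forall X Y (f : hom X Y), comp (idm Y) f = f;
  compm1 : forall X Y (f : hom X Y), comp f (idm X) = f;
  comp_linl : forall X Y Z (f : hom X Y), linear (fun g : hom Y Z => comp g f);
  comp_linr : forall X Y Z (g : hom Y Z), linear (fun f : hom X Y => comp g f)
}.

End Categories.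

Arguments idm {k c} X : rename.
Arguments comp {k c X Y Z} g f : rename.
Arguments hom {k c} X Y : rename.
Notation "g '\oc' f" := (comp g f)
  (at level 50, left associativity, format "g  '\oc'  f") : cat_scope.
Local Open Scope cat_scope.

Section CategoryTheory.

Variable k : fieldType.
Implicit Types C D : category k.

Record iso C (X Y : C) := Iso {
  fwd :> hom X Y;
  bwd : hom Y X;
  fwdK : bwd \oc fwd = idm X;
  bwdK : fwd \oc bwd = idm Y
}.

Record functor C D := Functor {
  fobj :> C -> D;
  fmap : forall X Y, hom X Y -> hom (fobj X) (fobj Y);
  fmap_lin : forall X Y, linear (@fmap X Y);
  fmap1 : forall X, fmap (idm X) = idm (fobj X);
  fmapM : forall X Y Z (g : hom Y Z) (f : hom X Y),
    fmap (g \oc f) = fmap g \oc fmap f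
}.

End CategoryTheory.

Arguments fmap {k C D} F {X Y} : rename.
Arguments bwd {k C X Y} i : rename.

Section Adjunctions.

Variable k : fieldType.
Implicit Types C D : category k.

Record nat_iso C D (F G : functor C D) := NatIso {
  niso :> forall X, iso (F X) (G X);
  niso_nat : forall X Y (f : hom X Y),
    niso Y \oc fmap F f = fmap G f \oc niso X
}.

Record adjunction C D (L : functor C D) (R : functor D C) := Adjunction {
  adj_unit : forall X : C, hom X (R (L X));
  adj_counit : forall Y : D, hom (L (R Y)) Y;
  adj_unit_nat : forall (X Y : C) (f : hom X Y),
    adj_unit Y \oc f = fmap R (fmap L f) \oc adj_unit X;
  adj_counit_nat : forall (X Y : D) (f : hom X Y),
    adj_counit Y \oc fmap L (fmap R f) = f \oc adj_counit X;
  adj_trianglel : forall X : C,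
    adj_counit (L X) \oc fmap L (adj_unit X) = idm (L X);
  adj_triangler : forall Y : D,
    fmap R (adj_counit Y) \oc adj_unit (R Y) = idm (R Y)
}.

Definition is_kernel C (X Y Z : C) (i : hom X Y) (p : hom Y Z) : Prop :=
  p \oc i = 0 /\
  forall (T : C) (t : hom T Y), p \oc t = 0 ->
    exists! u : hom T X, i \oc u = t.

Definition is_cokernel C (X Y Z : C) (p : hom Y Z) (i : hom X Y) : Prop :=
  p \oc i = 0 /\
  forall (T : C) (t : hom Y T), t \oc i = 0 ->
    exists! u : hom Z T, u \oc p = t.

Definition short_exact C (X Y Z : C) (i : hom X Y) (p : hom Y Z) : Prop :=
  is_kernel i p /\ is_cokernel p i.

Definition exact_functor C D (F : functor C D) : Prop :=
  forall (X Y Z : C) (i : hom X Y) (p : hom Y Z),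
    short_exact i p -> short_exact (fmap F i) (fmap F p).

Definition perfect_functor C D (F : functor C D) : Prop :=
  exists2 R : functor D C, inhabited (adjunction F R) & exact_functor R.

Definition frobenius_functor C D (F : functor C D) : Prop :=
  exists L R : functor D C, [/\ inhabited (adjunction L F),
    inhabited (adjunction F R) & inhabited (nat_iso L R)].

Record monoidal := Monoidal {
  mcat :> category k;
  mob : mcat -> mcat -> mcat;
  mhom : forall X X' Y Y' : mcat,
    hom X X' -> hom Y Y' -> hom (mob X Y) (mob X' Y');
  munit : mcat;
  massoc : forall X Y Z, iso (mob (mob X Y) Z) (mob X (mob Y Z));
  mlunit : forall X, iso (mob munit X) X;
  mrunit : forall X, iso (mob X munit) X;
  mhom1 : forall X Y, mhom (idm X) (idm Y) = idm (mob X Y);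
  mhomM : forall X X' X'' Y Y' Y'' (f' : hom X' X'') (f : hom X X')
      (g' : hom Y' Y'') (g : hom Y Y'),
    mhom (f' \oc f) (g' \oc g) = mhom f' g' \oc mhom f g;
  mhom_linl : forall X X' Y Y' (g : hom Y Y'),
    linear (fun f : hom X X' => mhom f g);
  mhom_linr : forall X X' Y Y' (f : hom X X'),
    linear (fun g : hom Y Y' => mhom f g);
  massoc_nat : forall X X' Y Y' Z Z' (f : hom X X') (g : hom Y Y')
      (h : hom Z Z'),
    massoc X' Y' Z' \oc mhom (mhom f g) h =
    mhom f (mhom g h) \oc massoc X Y Z;
  mlunit_nat : forall X X' (f : hom X X'),
    mlunit X' \oc mhom (idm munit) f = f \oc mlunit X;
  mrunit_nat : forall X X' (f : hom X X'),
    mrunit X' \oc mhom f (idm munit) = f \oc mrunit X;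
  mpentagon : forall X Y Z W,
    mhom (idm X) (massoc Y Z W) \oc massoc X (mob Y Z) W
      \oc mhom (massoc X Y Z) (idm W) =
    massoc X Y (mob Z W) \oc massoc (mob X Y) Z W;
  mtriangle : forall X Y,
    mhom (idm X) (mlunit Y) \oc massoc X munit Y = mhom (mrunit X) (idm Y)
}.

End Adjunctions.

Arguments munit {k m} : rename.
Notation "X '\ot' Y" := (mob X Y)
  (at level 40, left associativity, format "X  '\ot'  Y") : cat_scope.
Notation "f '\hot' g" := (mhom f g)
  (at level 40, left associativity, format "f  '\hot'  g") : cat_scope.

Section TensorFunctors.

Variable k : fieldType.
Implicit Types C D : monoidal k.

Record tensor_functor C D := TensorFunctor {
  tfun :> functor C D;
  tf_mul : forall X Y : C, iso (tfun X \ot tfun Y) (tfun (X \ot Y));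
  tf_one : iso (@munit k D) (tfun munit);
  tf_mul_nat : forall (X X' Y Y' : C) (f : hom X X') (g : hom Y Y'),
    tf_mul X' Y' \oc (fmap tfun f \hot fmap tfun g) =
    fmap tfun (f \hot g) \oc tf_mul X Y;
  tf_assoc : forall X Y Z : C,
    fmap tfun (massoc X Y Z) \oc tf_mul (X \ot Y) Z
      \oc (tf_mul X Y \hot idm (tfun Z)) =
    tf_mul X (Y \ot Z) \oc (idm (tfun X) \hot tf_mul Y Z)
      \oc massoc (tfun X) (tfun Y) (tfun Z);
  tf_lunit : forall X : C,
    fmap tfun (mlunit X) \oc tf_mul munit X \oc (tf_one \hot idm (tfun X)) =
    mlunit (tfun X);
  tf_runit : forall X : C,
    fmap tfun (mrunit X) \oc tf_mul X munit \oc (idm (tfun X) \hot tf_one) =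
    mrunit (tfun X)
}.

Variables (C D : monoidal k) (F : tensor_functor C D).

(* The module constraints of the C-bimodule category _F D_F, with actions
   c . d = F c \ot d and d . c = d \ot F c (its middle constraint is [massoc]). *)
Definition tw_lassoc (c c' : C) (d : D) :
    hom (F (c \ot c') \ot d) (F c \ot (F c' \ot d)) :=
  massoc (F c) (F c') d \oc (bwd (tf_mul F c c') \hot idm d).

Definition tw_lunit (d : D) : hom (F munit \ot d) d :=
  mlunit d \oc (bwd (tf_one F) \hot idm d).

Definition tw_rassoc (d : D) (c c' : C) :
    hom (d \ot F (c \ot c')) ((d \ot F c) \ot F c') :=
  bwd (massoc d (F c) (F c')) \oc (idm d \hot bwd (tf_mul F c c')).

Definition tw_runit (d : D) : hom (d \ot F munit) d :=
  mrunit d \oc (idm d \hot bwd (tf_one F)).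

(* C-bimodule functors from _F D_F to the regular C-bimodule category C. *)
Record bimod_functor := BimodFunctor {
  bfun :> functor D C;
  bl : forall (c : C) (d : D), iso (bfun (F c \ot d)) (c \ot bfun d);
  br : forall (d : D) (c : C), iso (bfun (d \ot F c)) (bfun d \ot c);
  bl_nat : forall (c c' : C) (d d' : D) (u : hom c c') (v : hom d d'),
    bl c' d' \oc fmap bfun (fmap F u \hot v) = (u \hot fmap bfun v) \oc bl c d;
  br_nat : forall (c c' : C) (d d' : D) (u : hom c c') (v : hom d d'),
    br d' c' \oc fmap bfun (v \hot fmap F u) = (fmap bfun v \hot u) \oc br d c;
  bl_assoc : forall (c c' : C) (d : D),
    (idm c \hot bl c' d) \oc bl c (F c' \ot d) \oc fmap bfun (tw_lassoc c c' d) =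
    massoc c c' (bfun d) \oc bl (c \ot c') d;
  bl_unit : forall d : D,
    mlunit (bfun d) \oc bl munit d = fmap bfun (tw_lunit d);
  br_assoc : forall (d : D) (c c' : C),
    (br d c \hot idm c') \oc br (d \ot F c) c' \oc fmap bfun (tw_rassoc d c c') =
    bwd (massoc (bfun d) c c') \oc br d (c \ot c');
  br_unit : forall d : D,
    mrunit (bfun d) \oc br d munit = fmap bfun (tw_runit d);
  b_middle : forall (c : C) (d : D) (c' : C),
    (idm c \hot br d c') \oc bl c (d \ot F c')
      \oc fmap bfun (massoc (F c) d (F c')) =
    massoc c (bfun d) c' \oc (bl c d \hot idm c') \oc br (F c \ot d) c'
}.

Record bimod_iso (G G' : bimod_functor) := BimodIso {
  biso :> nat_iso G G';
  biso_l : forall (c : C) (d : D),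
    bl G' c d \oc biso (F c \ot d) = (idm c \hot biso d) \oc bl G c d;
  biso_r : forall (d : D) (c : C),
    br G' d c \oc biso (d \ot F c) = (biso d \hot idm c) \oc br G d c
}.

(* The bimodule structure of a left adjoint L of F: its constraints are the
   mates of those of F : C -> _F D_F. *)
Definition induced_left (L : bimod_functor) (a : adjunction L F) : Prop :=
  (forall (c : C) (d : D),
    bl L c d = adj_counit a (c \ot L d)
      \oc fmap L (tf_mul F c (L d) \oc (idm (F c) \hot adj_unit a d))
    :> hom _ _) /\
  (forall (d : D) (c : C),
    br L d c = adj_counit a (L d \ot c)
      \oc fmap L (tf_mul F (L d) c \oc (adj_unit a d \hot idm (F c)))
    :> hom _ _).

(* For a right adjoint R the mates c \ot R d -> R (F c \ot d) and
   R d \ot c -> R (d \ot F c) are the inverses of the constraints. *)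
Definition induced_right (R : bimod_functor) (a : adjunction F R) : Prop :=
  (forall (c : C) (d : D),
    bwd (bl R c d) =
    fmap R ((idm (F c) \hot adj_counit a d) \oc bwd (tf_mul F c (R d)))
      \oc adj_unit a (c \ot R d)) /\
  (forall (d : D) (c : C),
    bwd (br R d c) =
    fmap R ((adj_counit a d \hot idm (F c)) \oc bwd (tf_mul F (R d) c))
      \oc adj_unit a (R d \ot c)).

Definition tensor_frobenius : Prop :=
  exists (L R : bimod_functor) (aL : adjunction L F) (aR : adjunction F R),
    [/\ induced_left aL, induced_right aR & inhabited (bimod_iso L R)].

End TensorFunctors.

Section Representations.

Variables (k : fieldType) (H : hopf k).

Record rep := Rep {
  rep_space :> vectType k;
  rep_act : 'Hom(H, 'End(rep_space));
  rep_act1 : rep_act 1 = \1%VF;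
  rep_actM : forall a b : H, rep_act (a * b) = (rep_act a \o rep_act b)%VF
}.

Definition intertwiner (V W : rep) : {pred 'Hom(V, W)} :=
  fun f => `[< forall h : H, (f \o rep_act V h)%VF = (rep_act W h \o f)%VF >].
Arguments intertwiner : clear implicits.

Fact intertwiner_submod (V W : rep) : submod_closed (intertwiner V W).
Proof.
split=> [|a f g].
  by apply/asboolP => h; apply/lfunP => v; rewrite !lfunE /= !lfunE /= linear0.
move=> /asboolP fP /asboolP gP; apply/asboolP => h.
rewrite comp_lfunDl comp_lfunDr -comp_lfunZl -comp_lfunZr.
by rewrite fP gP.
Qed.

HB.instance Definition _ (V W : rep) :=
  GRing.isSubmodClosed.Build k 'Hom(V, W) (intertwiner V W)
    (intertwiner_submod V W).

Record rep_hom (V W : rep) := RepHom {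
  rep_hom_fun :> 'Hom(V, W);
  rep_homP : rep_hom_fun \in intertwiner V W
}.

HB.instance Definition _ (V W : rep) := [isSub for @rep_hom_fun V W].
HB.instance Definition _ (V W : rep) := [Choice of rep_hom V W by <:].
HB.instance Definition _ (V W : rep) :=
  [SubChoice_isSubLmodule of rep_hom V W by <:].

Lemma rep_homE (V W : rep) (f : rep_hom V W) h v :
  f (rep_act V h v) = rep_act W h (f v).
Proof.
have /asboolP/(_ h)/lfunP/(_ v) := rep_homP f.
by rewrite !lfunE.
Qed.

Lemma rep_hom_ext (V W : rep) (f g : rep_hom V W) :
  rep_hom_fun f = rep_hom_fun g -> f = g.
Proof. exact: val_inj. Qed.

Lemma intertwinerP (V W : rep) (f : 'Hom(V, W)) :
  (forall h v, f (rep_act V h v) = rep_act W h (f v)) ->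
  f \in intertwiner V W.
Proof.
by move=> fP; apply/asboolP => h; apply/lfunP => v; rewrite !lfunE /= fP.
Qed.

Fact rep_idm_subproof (V : rep) : \1%VF \in intertwiner V V.
Proof. by apply: intertwinerP => h v; rewrite !id_lfunE. Qed.

Definition rep_idm (V : rep) : rep_hom V V := RepHom (rep_idm_subproof V).

Fact rep_comp_subproof (V W X : rep) (g : rep_hom W X) (f : rep_hom V W) :
  (g \o f)%VF \in intertwiner V X.
Proof.
by apply: intertwinerP => h v; rewrite !comp_lfunE !rep_homE.
Qed.

Definition rep_comp (V W X : rep) (g : rep_hom W X) (f : rep_hom V W) :
  rep_hom V X := RepHom (rep_comp_subproof g f).

Lemma rep_homP_eq (V W : rep) (f g : rep_hom V W) : f =1 g -> f = g.
Proof. by move=> fg; apply: rep_hom_ext; apply/lfunP. Qed.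

Lemma rep_homDZ (V W : rep) a (f g : rep_hom V W) v :
  (a *: f + g : rep_hom V W) v = a *: f v + g v.
Proof. by rewrite /= !lfunE /= lfunE. Qed.

Definition rep_category : category k.
Proof.
refine (@Category k rep (fun V W => rep_hom V W : lmodType k) rep_idm
  rep_comp _ _ _ _ _).
- by move=> *; apply: rep_homP_eq => v /=; rewrite !comp_lfunE.
- by move=> *; apply: rep_homP_eq => v /=; rewrite comp_lfunE id_lfunE.
- by move=> *; apply: rep_homP_eq => v /=; rewrite comp_lfunE id_lfunE.
- move=> V W X f a g g'; apply: rep_homP_eq => v.
  by rewrite rep_homDZ /= !comp_lfunE rep_homDZ.
- move=> V W X g a f f'; apply: rep_homP_eq => v.
  by rewrite rep_homDZ /= !comp_lfunE rep_homDZ linearP.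
Defined.

End Representations.

Arguments intertwiner {k H} V W : rename.

Section RepMonoidal.

Variables (k : fieldType) (H : hopf k).
Implicit Types V W X Y Z : rep H.

Lemma comul_assoc (X : vectType k) (E : H -> H -> H -> X) (h : H) :
  (forall b c, linear (fun a => E a b c)) ->
  (forall a c, linear (fun b => E a b c)) ->
  (forall a b, linear (fun c => E a b c)) ->
  tlift (fun a b => tlift (fun a1 a2 => E a1 a2 b) (comul H a)) (comul H h) =
  tlift (fun a b => tlift (fun b1 b2 => E a b1 b2) (comul H b)) (comul H h).
Proof.
move=> l1 l2 l3.
pose Phi := tlift (fun a t => tlift (fun b c => E a b c) t) :
  'Hom(tensor H (tensor H H), X).
have bE a : bilin (E a) by split=> ?; [exact: l2 | exact: l3].
have PhiE a b c : Phi (pure a (pure b c)) = E a b c.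
  rewrite /Phi tlift_pure ?tlift_pure //.
  split=> [t x y z|x y z w] /=; last exact: linearP.
  by rewrite -tliftDl; congr (fun_of_lfun _ _); apply: eq_tlift => u v; apply: l1.
have := congr1 Phi (comulA h).
have [T TE] : exists T, T = tassoc H H H by exists (tassoc H H H).
rewrite -TE /tmap [T _]tlift_lin [LHS]tlift_lin [RHS]tlift_lin => e.
transitivity (tlift (fun u v => Phi (T (pure (comul H u) (\1%VF v))))
  (comul H h)).
  congr (fun_of_lfun _ _); apply: eq_tlift => a b /=; rewrite id_lfunE TE.
  have hl : linear (fun t : tensor H H => Phi (tassoc H H H (pure t b))).
    by move=> x y z; rewrite pureDl !linearP.
  rewrite -(linfunP hl); congr (fun_of_lfun _ _).
  apply: tensor_ext => u v; rewrite (linfunP hl) tassoc_pure PhiE tlift_pure //.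
apply: (etrans e); congr (fun_of_lfun _ _); apply: eq_tlift => a b /=; rewrite id_lfunE.
rewrite /Phi tlift_pure //.
split=> [t x y z|x y z w] /=; last exact: linearP.
by rewrite -tliftDl; congr (fun_of_lfun _ _); apply: eq_tlift => u v; apply: l1.
Qed.

Definition rep_ot_act V W : 'Hom(H, 'End(tensor V W)) :=
  (tlift (fun a b => tmap (rep_act V a) (rep_act W b)) \o comul H)%VF.

Lemma rep_ot_actE V W (h : H) (t : tensor V W) :
  rep_ot_act V W h t =
  tlift (fun a b => tmap (rep_act V a) (rep_act W b) t) (comul H h).
Proof. by rewrite comp_lfunE tlift_app. Qed.

Lemma rep_ot_act_pure V W (h : H) (v : V) (w : W) :
  rep_ot_act V W h (pure v w) =
  tlift (fun a b => pure (rep_act V a v) (rep_act W b w)) (comul H h).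
Proof.
rewrite rep_ot_actE; congr (fun_of_lfun _ _).
by apply: eq_tlift => a b; rewrite tmap_pure.
Qed.

Lemma rep_act_pure_bilin V W (v : V) (w : W) :
  bilin (fun a b : H => pure (rep_act V a v) (rep_act W b w)).
Proof.
by split=> [b x y z|a x y z]; rewrite linearP /= add_lfunE scale_lfunE
  ?pureDl ?pureDr.
Qed.

Fact rep_ot_act1 V W : rep_ot_act V W 1 = \1%VF.
Proof.
apply: tensor_ext => v w; rewrite rep_ot_act_pure comul1 id_lfunE.
rewrite tlift_pure ?rep_act1 ?id_lfunE //.
exact: rep_act_pure_bilin.
Qed.

Fact rep_ot_actM V W (a b : H) :
  rep_ot_act V W (a * b) = (rep_ot_act V W a \o rep_ot_act V W b)%VF.
Proof.
apply: tensor_ext => v w; rewrite [RHS]comp_lfunE.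
rewrite [rep_ot_act V W a _]rep_ot_actE !rep_ot_act_pure comulM.
rewrite tlift_lin; congr (fun_of_lfun _ _); apply: eq_tlift => a1 a2.
rewrite !tlift_lin; congr (fun_of_lfun _ _); apply: eq_tlift => b1 b2.
rewrite tlift_pure ?tmap_pure ?rep_actM ?comp_lfunE //.
exact: rep_act_pure_bilin.
Qed.

Definition rep_ot V W : rep H := Rep (rep_ot_act1 V W) (rep_ot_actM V W).

Fact rep_ot_hom_subproof V V' W W' (f : rep_hom V V') (g : rep_hom W W') :
  tmap f g \in intertwiner (rep_ot V W) (rep_ot V' W').
Proof.
apply/asboolP => h; apply: tensor_ext => v w.
rewrite [LHS]comp_lfunE [RHS]comp_lfunE /= tmap_pure !rep_ot_act_pure tlift_lin.
congr (fun_of_lfun _ _); apply: eq_tlift => a b.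
by rewrite tmap_pure !rep_homE.
Qed.

Definition rep_ot_hom V V' W W' (f : rep_hom V V') (g : rep_hom W W') :
  rep_hom (rep_ot V W) (rep_ot V' W') := RepHom (rep_ot_hom_subproof f g).

Fact rep_unit_lin : linear (fun h : H => (counit H h : k) *: (\1%VF : 'End(k^o))).
Proof. by move=> a x y; rewrite linearP scalerDl scalerA. Qed.

Definition rep_unit_act : 'Hom(H, 'End(k^o)) :=
  linfun (fun h : H => (counit H h : k) *: (\1%VF : 'End(k^o))).

Lemma rep_unit_actE (h : H) (x : k^o) : rep_unit_act h x = (counit H h : k) *: x.
Proof. by rewrite (linfunP rep_unit_lin) scale_lfunE id_lfunE. Qed.

Fact rep_unit_act1 : rep_unit_act 1 = \1%VF.
Proof. by apply/lfunP => x; rewrite rep_unit_actE rmorph1 scale1r id_lfunE. Qed.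

Fact rep_unit_actM (a b : H) :
  rep_unit_act (a * b) = (rep_unit_act a \o rep_unit_act b)%VF.
Proof.
by apply/lfunP => x; rewrite comp_lfunE !rep_unit_actE rmorphM scalerA.
Qed.

Definition rep_unit : rep H := Rep rep_unit_act1 rep_unit_actM.

Section RepIso.
Variables (V W : rep H) (f : rep_hom V W) (g : 'Hom(W, V)).
Hypotheses (fK : cancel f g) (gK : cancel g f).

Fact rep_bwd_subproof : g \in intertwiner W V.
Proof.
by apply: intertwinerP => h w; rewrite -{1}[w]gK -rep_homE fK.
Qed.

Fact rep_fwdK_subproof : rep_comp (RepHom rep_bwd_subproof) f = rep_idm V.
Proof. by apply: rep_homP_eq => v; rewrite /= comp_lfunE id_lfunE /= fK. Qed.

Fact rep_bwdK_subproof : rep_comp f (RepHom rep_bwd_subproof) = rep_idm W.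
Proof. by apply: rep_homP_eq => v; rewrite /= comp_lfunE id_lfunE /= gK. Qed.

Definition rep_iso : iso (V : rep_category H) (W : rep_category H) :=
  @Iso k (rep_category H) V W f (RepHom rep_bwd_subproof)
    rep_fwdK_subproof rep_bwdK_subproof.
End RepIso.

Fact rep_assoc_subproof V W X :
  tassoc V W X \in intertwiner (rep_ot (rep_ot V W) X) (rep_ot V (rep_ot W X)).
Proof.
apply/asboolP => h; apply: tensor3_ext => v w x.
rewrite [LHS]comp_lfunE [RHS]comp_lfunE tassoc_pure.
rewrite -[rep_act (rep_ot _ _) h]/(rep_ot_act _ _ h).
rewrite -[rep_act (rep_ot V _) h]/(rep_ot_act _ _ h).
rewrite (@rep_ot_act_pure (rep_ot V W) X h (pure v w : rep_ot V W) x).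
rewrite (@rep_ot_act_pure V (rep_ot W X) h v (pure w x : rep_ot W X)).
rewrite tlift_lin /=.
transitivity (tlift (fun a b => tlift (fun a1 a2 =>
  pure (rep_act V a1 v) (pure (rep_act W a2 w) (rep_act X b x))) (comul H a))
    (comul H h)).
  congr (fun_of_lfun _ _); apply: eq_tlift => a b.
  rewrite rep_ot_act_pure.
  have hl : linear (fun t : tensor V W => tassoc V W X (pure t (rep_act X b x))).
    by move=> ? ? ?; rewrite pureDl linearP.
  rewrite -[LHS](linfunP hl) tlift_lin.
  congr (fun_of_lfun _ _); apply: eq_tlift => a1 a2.
  by rewrite (linfunP hl) tassoc_pure.
rewrite (@comul_assoc _ (fun a b c =>
  pure (rep_act V a v) (pure (rep_act W b w) (rep_act X c x)))).
- congr (fun_of_lfun _ _); apply: eq_tlift => a b.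
  rewrite rep_ot_act_pure.
  have hl : linear (fun t : tensor W X => pure (rep_act V a v) t).
    by move=> ? ? ?; rewrite pureDr.
  rewrite -[RHS](linfunP hl) tlift_lin.
  by congr (fun_of_lfun _ _); apply: eq_tlift => a1 a2; rewrite (linfunP hl).
- by move=> b c ? ? ?; rewrite linearP add_lfunE scale_lfunE pureDl.
- by move=> b c ? ? ?; rewrite linearP add_lfunE scale_lfunE pureDl pureDr.
- by move=> b c ? ? ?; rewrite linearP add_lfunE scale_lfunE !pureDr.
Qed.

Definition rep_assoc V W X :=
  rep_iso (f := RepHom (rep_assoc_subproof V W X))
    (@tassocK k V W X) (@tassocVK k V W X).

Definition tlunit (V : vectType k) : 'Hom(tensor k^o V, V) :=
  tlift (fun (a : k^o) v => (a : k) *: v).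

Definition tlunitV (V : vectType k) : 'Hom(V, tensor k^o V) :=
  linfun (fun v => pure (1 : k^o) v).

Definition trunit (V : vectType k) : 'Hom(tensor V k^o, V) :=
  tlift (fun v (a : k^o) => (a : k) *: v).

Definition trunitV (V : vectType k) : 'Hom(V, tensor V k^o) :=
  linfun (fun v => pure v (1 : k^o)).

Lemma tlunit_pure (V : vectType k) (a : k^o) (v : V) :
  tlunit V (pure a v) = (a : k) *: v.
Proof.
rewrite /tlunit tlift_pure //; split=> [w c x y|b c x y] /=.
  by rewrite scalerDl scalerA.
by rewrite scalerDr !scalerA mulrC.
Qed.

Lemma trunit_pure (V : vectType k) (a : k^o) (v : V) :
  trunit V (pure v a) = (a : k) *: v.
Proof.
rewrite /trunit tlift_pure //; split=> [w c x y|b c x y] /=.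
  by rewrite scalerDr !scalerA mulrC.
by rewrite scalerDl scalerA.
Qed.

Lemma tlunitVE (V : vectType k) (v : V) : tlunitV V v = pure (1 : k^o) v.
Proof. by rewrite (linfunP (f := pure (1 : k^o))) // => a x y; rewrite pureDr. Qed.

Lemma trunitVE (V : vectType k) (v : V) : trunitV V v = pure v (1 : k^o).
Proof.
by rewrite (linfunP (f := fun v : V => pure v (1 : k^o))) // => a x y;
  rewrite pureDl.
Qed.

Lemma pureZl (U V : vectType k) a (u : U) (v : V) :
  pure (a *: u) v = a *: pure u v.
Proof.
have pure0 : pure 0 v = 0 :> tensor U V.
  by have := pureDl (-1) (0 : U) 0 v; rewrite !scaleN1r !addNr.
by rewrite -[a *: u]addr0 pureDl pure0 addr0.
Qed.

Lemma pureZr (U V : vectType k) a (u : U) (v : V) :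
  pure u (a *: v) = a *: pure u v.
Proof.
have pure0 : pure u 0 = 0 :> tensor U V.
  by have := pureDr (-1) u (0 : V) 0; rewrite !scaleN1r !addNr.
by rewrite -[a *: v]addr0 pureDr pure0 addr0.
Qed.

Lemma tlunitK (V : vectType k) : cancel (tlunit V) (tlunitV V).
Proof.
move=> t; rewrite -comp_lfunE -[RHS]id_lfunE; congr (fun_of_lfun _ t).
apply: tensor_ext => a v; rewrite comp_lfunE tlunit_pure tlunitVE id_lfunE.
by rewrite pureZr -pureZl /GRing.scale /= mulr1.
Qed.

Lemma tlunitVK (V : vectType k) : cancel (tlunitV V) (tlunit V).
Proof. by move=> v; rewrite tlunitVE tlunit_pure scale1r. Qed.

Lemma trunitK (V : vectType k) : cancel (trunit V) (trunitV V).
Proof.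
move=> t; rewrite -comp_lfunE -[RHS]id_lfunE; congr (fun_of_lfun _ t).
apply: tensor_ext => v a; rewrite comp_lfunE trunit_pure trunitVE id_lfunE.
by rewrite pureZl -pureZr /GRing.scale /= mulr1.
Qed.

Lemma trunitVK (V : vectType k) : cancel (trunitV V) (trunit V).
Proof. by move=> v; rewrite trunitVE trunit_pure scale1r. Qed.

Lemma comul_counitl (V : rep H) (h : H) (v : V) :
  tlift (fun a b => (counit H a : k) *: rep_act V b v) (comul H h) =
  rep_act V h v.
Proof.
rewrite -{2}(counitl h) tlift_lin tlift_app; congr (fun_of_lfun _ _).
by apply: eq_tlift => a b; rewrite linearZ /= scale_lfunE.
Qed.

Lemma comul_counitr (V : rep H) (h : H) (v : V) :
  tlift (fun a b => (counit H b : k) *: rep_act V a v) (comul H h) =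
  rep_act V h v.
Proof.
rewrite -{2}(counitr h) tlift_lin tlift_app; congr (fun_of_lfun _ _).
by apply: eq_tlift => a b; rewrite linearZ /= scale_lfunE.
Qed.

Fact rep_lunit_subproof V : tlunit V \in intertwiner (rep_ot rep_unit V) V.
Proof.
apply/asboolP => h; apply: tensor_ext => a v.
rewrite [LHS]comp_lfunE [RHS]comp_lfunE tlunit_pure.
rewrite -[rep_act (rep_ot _ _) h]/(rep_ot_act _ _ h).
rewrite (@rep_ot_act_pure rep_unit V h a v) tlift_lin -comul_counitl.
congr (fun_of_lfun _ _); apply: eq_tlift => x y.
rewrite -[rep_act rep_unit x]/(rep_unit_act x) rep_unit_actE tlunit_pure.
by rewrite linearZ /= scalerA.
Qed.

Fact rep_runit_subproof V : trunit V \in intertwiner (rep_ot V rep_unit) V.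
Proof.
apply/asboolP => h; apply: tensor_ext => v a.
rewrite [LHS]comp_lfunE [RHS]comp_lfunE trunit_pure.
rewrite -[rep_act (rep_ot _ _) h]/(rep_ot_act _ _ h).
rewrite (@rep_ot_act_pure V rep_unit h v a) tlift_lin -comul_counitr.
congr (fun_of_lfun _ _); apply: eq_tlift => x y.
rewrite -[rep_act rep_unit y]/(rep_unit_act y) rep_unit_actE trunit_pure.
by rewrite linearZ /= scalerA.
Qed.

Definition rep_lunit V :=
  rep_iso (f := RepHom (rep_lunit_subproof V)) (@tlunitK V) (@tlunitVK V).

Definition rep_runit V :=
  rep_iso (f := RepHom (rep_runit_subproof V)) (@trunitK V) (@trunitVK V).

Definition rep_monoidal : monoidal k.
Proof.
refine (@Monoidal k (rep_category H) rep_ot rep_ot_hom rep_unit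
  rep_assoc rep_lunit rep_runit _ _ _ _ _ _ _ _ _).
- move=> V W; apply: rep_hom_ext; apply: tensor_ext => v w /=.
  by rewrite tmap_pure !id_lfunE.
- move=> V V' V'' W W' W'' f' f g' g; apply: rep_hom_ext.
  apply: tensor_ext => v w /=.
  by rewrite [RHS]comp_lfunE !tmap_pure !comp_lfunE.
- move=> V V' W W' g a f f'; apply: rep_hom_ext; apply: tensor_ext => v w.
  apply: etrans (esym (rep_homDZ a (rep_ot_hom f g) (rep_ot_hom f' g) _)).
  by rewrite /= !tmap_pure -pureDl; congr (pure _ _); apply: rep_homDZ.
- move=> V V' W W' f a g g'; apply: rep_hom_ext; apply: tensor_ext => v w.
  apply: etrans (esym (rep_homDZ a (rep_ot_hom f g) (rep_ot_hom f g') _)).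
  by rewrite /= !tmap_pure -pureDr; congr (pure _ _); apply: rep_homDZ.
- move=> V V' W W' X X' f g h; apply: rep_hom_ext.
  apply: tensor3_ext => v w x /=.
  rewrite [LHS]comp_lfunE [RHS]comp_lfunE tassoc_pure.
  by rewrite !tmap_pure tassoc_pure.
- move=> V V' f; apply: rep_hom_ext; apply: tensor_ext => a v /=.
  rewrite [LHS]comp_lfunE [RHS]comp_lfunE tmap_pure !tlunit_pure id_lfunE.
  by rewrite linearZ.
- move=> V V' f; apply: rep_hom_ext; apply: tensor_ext => v a /=.
  rewrite [LHS]comp_lfunE [RHS]comp_lfunE tmap_pure !trunit_pure id_lfunE.
  by rewrite linearZ.
- move=> V W X Y; apply: rep_hom_ext => /=.
  apply: tensor4_ext => v w x y.
  rewrite [LHS]comp_lfunE [in LHS]comp_lfunE [RHS]comp_lfunE.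
  rewrite tmap_pure tassoc_pure id_lfunE.
  rewrite (@tassoc_pure k V (rep_ot W X) Y) tmap_pure tassoc_pure id_lfunE.
  by rewrite !tassoc_pure.
- move=> V W; apply: rep_hom_ext; apply: tensor3_ext => v a w /=.
  rewrite [LHS]comp_lfunE tassoc_pure !tmap_pure tlunit_pure trunit_pure.
  by rewrite !id_lfunE pureZl pureZr.
Defined.

End RepMonoidal.

Section Restriction.

Variables (k : fieldType) (H' H : hopf k) (f : bialg_map H' H).
Implicit Types V W : rep H.

Definition res_act V : 'Hom(H', 'End(V)) := (rep_act V \o linfun f)%VF.

Lemma res_actE V (h : H') : res_act V h = rep_act V (f h).
Proof. by rewrite comp_lfunE lfunE. Qed.

Fact res_act1 V : res_act V 1 = \1%VF.
Proof. by rewrite res_actE rmorph1 rep_act1. Qed.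

Fact res_actM V (a b : H') :
  res_act V (a * b) = (res_act V a \o res_act V b)%VF.
Proof. by rewrite !res_actE rmorphM rep_actM. Qed.

Definition res_rep V : rep H' := Rep (res_act1 V) (res_actM V).

Fact res_hom_subproof V W (g : rep_hom V W) :
  rep_hom_fun g \in intertwiner (res_rep V) (res_rep W).
Proof. by apply: intertwinerP => h v; rewrite /= !res_actE rep_homE. Qed.

Definition res_hom V W (g : rep_hom V W) : rep_hom (res_rep V) (res_rep W) :=
  RepHom (res_hom_subproof g).

Definition res_functor : functor (rep_category H) (rep_category H').
Proof.
refine (@Functor k (rep_category H) (rep_category H') res_rep res_hom _ _ _).
- by move=> V W a g g'; apply: rep_homP_eq => v;
  exact: etrans (rep_homDZ a g g' v)
    (esym (rep_homDZ a (res_hom g) (res_hom g') v)).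
- by move=> V; apply: rep_homP_eq.
- by move=> V W X g g'; apply: rep_homP_eq.
Defined.

(* F_f X (x) F_f Y and F_f (X (x) Y) have the same underlying space. *)
Fact res_mul_subproof V W :
  \1%VF \in intertwiner (rep_ot (res_rep V) (res_rep W)) (res_rep (rep_ot V W)).
Proof.
apply: intertwinerP => h t; rewrite !id_lfunE.
rewrite -[rep_act (rep_ot _ _) h]/(rep_ot_act _ _ h).
rewrite -[rep_act (res_rep _) h]/(res_act _ h) res_actE.
rewrite -[rep_act (rep_ot _ _) _]/(rep_ot_act _ _ _).
rewrite !rep_ot_actE bialg_comul.
rewrite tlift_lin; congr (fun_of_lfun _ _); apply: eq_tlift => a b.
rewrite tlift_pure -?[rep_act (res_rep _) _]/(res_act _ _) ?res_actE //.
split=> [c x y z|c x y z]; rewrite linearP.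
  by rewrite tmapDl add_lfunE scale_lfunE.
by rewrite tmapDr add_lfunE scale_lfunE.
Qed.

Definition res_mul V W :
    iso (rep_ot (res_rep V) (res_rep W) : rep_category H')
        (res_rep (rep_ot V W) : rep_category H') :=
  rep_iso (f := RepHom (res_mul_subproof V W)) (g := \1%VF)
    (fun t => etrans (id_lfunE _) (id_lfunE t))
    (fun t => etrans (id_lfunE _) (id_lfunE t)).

Fact res_one_subproof :
  \1%VF \in intertwiner (rep_unit H') (res_rep (rep_unit H)).
Proof.
apply: intertwinerP => h t; rewrite !id_lfunE.
rewrite -[rep_act (res_rep _) h]/(res_act _ h) res_actE.
by rewrite !rep_unit_actE bialg_counit.
Qed.

Definition res_one : iso (rep_unit H' : rep_category H')
    (res_rep (rep_unit H) : rep_category H') :=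
  rep_iso (f := RepHom res_one_subproof) (g := \1%VF)
    (fun t => etrans (id_lfunE _) (id_lfunE t))
    (fun t => etrans (id_lfunE _) (id_lfunE t)).

Definition res_tensor_functor : tensor_functor (rep_monoidal H) (rep_monoidal H').
Proof.
refine (@TensorFunctor k (rep_monoidal H) (rep_monoidal H') res_functor
  res_mul res_one _ _ _ _).
- move=> V V' W W' g g'; apply: rep_hom_ext => /=.
  by rewrite comp_lfun1l comp_lfun1r.
- move=> V W X; apply: rep_hom_ext; apply: tensor3_ext => v w x /=.
  rewrite !comp_lfun1r !comp_lfun1l [LHS]comp_lfunE [RHS]comp_lfunE.
  by rewrite tassoc_pure !tmap_pure !id_lfunE tassoc_pure.
- move=> V; apply: rep_hom_ext; apply: tensor_ext => a v /=.
  by rewrite comp_lfun1r [LHS]comp_lfunE tmap_pure !id_lfunE.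
- move=> V; apply: rep_hom_ext; apply: tensor_ext => v a /=.
  by rewrite comp_lfun1r [LHS]comp_lfunE tmap_pure !id_lfunE.
Defined.

End Restriction.

(* Main.v *)
(* Idea: write [Lambda], [lam] for an integral and a cointegral.  By the Hopf
   module argument [lam] is a Frobenius form on [H], with Nakayama automorphism
   given by the modular function.  The right adjoint of restriction is
   [R V = Hom_H' (H, V)], and an isomorphism between the left and the right
   adjoint amounts to an [H']-bimodule map [E : H -> H'] with [E (h x) = 0] for
   all [h] only if [x = 0].
   - Given [E], [E Lambda] is a nonzero left integral of [H'], and comparing
     right multiplications by [f h'] gives [alpha_H \o f = alpha_H'].
   - Conversely [lam' (E h * x) = lam (h * f x)] defines a map [E], which is a
     bimodule map exactly when the Nakayama automorphisms match.  A dual basis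
     of the projective module [H] then makes [(E, x_i, y_i)] a Frobenius system,
     and [R] itself becomes a left adjoint of restriction.
   - The isomorphism respects the bimodule structures iff [E] is [H]-colinear on
     both sides.  Right colinearity of the [E] above is automatic; in general
     two-sided colinearity makes [lam' \o E] a right cointegral with
     distinguished grouplike element [f g_H'], which forces [f g_H' = g_H].
     Conversely [f g_H' = g_H] gives left colinearity, and then the left and
     right mates are mutually inverse. *)

From HB Require Import structures.
Require Import Defs.
From mathcomp Require Import all_boot all_algebra all_field.

Set Implicit Arguments.
Unset Strict Implicit.
Unset Printing Implicit Defensive.

Import GRing.Theory.
Local Open Scope ring_scope.
Local Open Scope cat_scope.

(* The [hom] of [vector] shadows the one of [Defs]. *)
Local Notation rep_mor K := (@Defs.hom _ (rep_category K)).

(** * Tensors and Sweedler calculus *)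

Section Linearity.

Variable k : fieldType.
Implicit Types U V W X : vectType k.

Lemma lin_id U : linear (fun x : U => x).
Proof. by []. Qed.

Lemma lin_lfun U V W (g : 'Hom(V, W)) (f : U -> V) :
  linear f -> linear (fun x => g (f x)).
Proof. by move=> fl c x y; rewrite fl linearP. Qed.

Lemma lin_comp U V W (g : {linear V -> W}) (f : U -> V) :
  linear f -> linear (fun x => g (f x)).
Proof. by move=> fl c x y; rewrite fl linearP. Qed.

Lemma lin_app U V W (F : U -> 'Hom(V, W)) (v : V) :
  linear F -> linear (fun x => F x v).
Proof. by move=> Fl c x y; rewrite Fl add_lfunE scale_lfunE. Qed.

Lemma lin_mull U (A : falgType k) (a : A) (f : U -> A) :
  linear f -> linear (fun x => a * f x).
Proof. by move=> fl c x y; rewrite fl mulrDr scalerAr. Qed.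

Lemma lin_mulr U (A : falgType k) (a : A) (f : U -> A) :
  linear f -> linear (fun x => f x * a).
Proof. by move=> fl c x y; rewrite fl mulrDl scalerAl. Qed.

Lemma lin_scalel U V (phi : U -> k^o) (v : V) :
  linear phi -> linear (fun x => (phi x : k) *: v).
Proof. by move=> fl c x y; rewrite fl scalerDl scalerA. Qed.

Lemma lin_scaler U V (c : k) (f : U -> V) :
  linear f -> linear (fun x => c *: f x).
Proof. by move=> fl a x y; rewrite fl scalerDr !scalerA mulrC. Qed.

Lemma lin_purel U V W (f : U -> V) (w : W) :
  linear f -> linear (fun x => pure (f x) w).
Proof. by move=> fl c x y; rewrite fl pureDl. Qed.

Lemma lin_purer U V W (f : U -> V) (w : W) :
  linear f -> linear (fun x => pure w (f x)).
Proof. by move=> fl c x y; rewrite fl pureDr. Qed.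

Lemma lin_tlift U V W X (F : U -> V -> W -> X) (t : tensor V W) :
  (forall v w, linear (fun x => F x v w)) -> linear (fun x => tlift (F x) t).
Proof.
move=> Fl c x y; rewrite -tliftDl; congr (fun_of_lfun _ _).
by apply: eq_tlift => v w; apply: Fl.
Qed.

Lemma lin_add U V (f g : U -> V) :
  linear f -> linear g -> linear (fun x => f x + g x).
Proof. by move=> fl gl c x y; rewrite fl gl scalerDr addrACA. Qed.

Lemma lin_opp U V (f : U -> V) : linear f -> linear (fun x => - f x).
Proof. by move=> fl c x y; rewrite fl scalerN opprD. Qed.

Lemma lin_sum U V (I : Type) (r : seq I) (F : I -> U -> V) :
  (forall i, linear (F i)) -> linear (fun x => \sum_(i <- r) F i x).
Proof.
move=> Fl c x y; rewrite scaler_sumr -big_split /=.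
by apply: eq_bigr => i _; apply: Fl.
Qed.

End Linearity.

Ltac lin := intros; repeat (first
  [ exact: lin_id | eassumption
  | apply: lin_sum; intros | apply: lin_tlift; intros
  | apply: lin_mull | apply: lin_mulr | apply: lin_purel | apply: lin_purer
  | apply: lin_lfun | apply: lin_comp | apply: lin_app
  | apply: lin_scalel | apply: lin_scaler | apply: lin_opp | apply: lin_add ]).

Ltac bil := let x := fresh in split=> x; lin.

Notation "\sw_ ( a , b <- h ) E" := (tlift (fun a b => E) (comul _ h))
  (at level 41, E at level 41, a name, b name, h at level 50,
   format "\sw_ ( a ,  b  <-  h )  E").

Section TensorCalculus.

Variable k : fieldType.
Implicit Types U V W X : vectType k.

Lemma tlift_map U1 U2 V W (g : V -> W) (E : U1 -> U2 -> V) t :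
  linear g -> g (tlift E t) = tlift (fun a b => g (E a b)) t.
Proof.
move=> gl; rewrite -(linfunP gl) tlift_lin; congr (fun_of_lfun _ _).
by apply: eq_tlift => a b; rewrite (linfunP gl).
Qed.

Lemma exchange_tlift U1 U2 U3 U4 V (E : U1 -> U2 -> U3 -> U4 -> V) t u :
  tlift (fun a b => tlift (fun c d => E a b c d) u) t =
  tlift (fun c d => tlift (fun a b => E a b c d) t) u.
Proof.
rewrite [LHS]tliftE [RHS]tliftE.
under eq_bigr do under eq_bigr do rewrite tliftE scaler_sumr.
under [RHS]eq_bigr do under eq_bigr do rewrite tliftE scaler_sumr.
under eq_bigr do rewrite exchange_big /=.
rewrite exchange_big; apply: eq_bigr => i _.
under eq_bigr do under eq_bigr do rewrite scaler_sumr.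
under [RHS]eq_bigr do under eq_bigr do rewrite scaler_sumr.
under eq_bigr do rewrite exchange_big /=.
rewrite exchange_big; apply: eq_bigr => j _ /=.
apply: eq_bigr => p _; apply: eq_bigr => q _.
by rewrite !scalerA mulrC.
Qed.

Lemma sum_tlift (I : Type) (r : seq I) U1 U2 V (E : I -> U1 -> U2 -> V) t :
  \sum_(i <- r) tlift (E i) t = tlift (fun a b => \sum_(i <- r) E i a b) t.
Proof.
elim: r => [|i r IH].
  rewrite big_nil tliftE; apply/esym/big1 => i _; apply: big1 => j _.
  by rewrite big_nil scaler0.
rewrite big_cons IH -[tlift _ t]scale1r -tliftDl; congr (fun_of_lfun _ _).
by apply: eq_tlift => a b; rewrite big_cons scale1r.
Qed.

Lemma tlift_pure_id U V (t : tensor U V) : tlift (@pure k U V) t = t.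
Proof.
rewrite -[RHS]id_lfunE; congr (fun_of_lfun _ _).
apply: tensor_ext => u v; rewrite tlift_pure ?id_lfunE //; bil.
Qed.

Lemma tensor_lin_ext U V W (g h : tensor U V -> W) :
  linear g -> linear h -> (forall u v, g (pure u v) = h (pure u v)) ->
  forall t, g t = h t.
Proof.
move=> gl hl gh t; rewrite -(linfunP gl) -(linfunP hl); congr (fun_of_lfun _ t).
by apply: tensor_ext => u v; rewrite (linfunP gl) (linfunP hl).
Qed.

End TensorCalculus.

Section Sweedler.

Variables (k : fieldType) (H : hopf k).
Implicit Types (V W X : vectType k) (a b c h x y : H).

Lemma eq_sw V (E E' : H -> H -> V) h :
  E =2 E' -> \sw_(a, b <- h) E a b = \sw_(a, b <- h) E' a b.
Proof. by move=> eqE; congr (fun_of_lfun _ _); apply: eq_tlift. Qed.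

Lemma sw_counitl V (F : H -> V) h :
  linear F -> \sw_(a, b <- h) (counit H a : k) *: F b = F h.
Proof.
move=> Fl; rewrite -[in RHS](counitl h) (tlift_map _ _ Fl); apply: eq_sw => a b.
by rewrite -!(linfunP Fl) linearZ.
Qed.

Lemma sw_counitr V (F : H -> V) h :
  linear F -> \sw_(a, b <- h) (counit H b : k) *: F a = F h.
Proof.
move=> Fl; rewrite -[in RHS](counitr h) (tlift_map _ _ Fl); apply: eq_sw => a b.
by rewrite -!(linfunP Fl) linearZ.
Qed.

Lemma sw_antipodel V (F : H -> V) h :
  linear F -> \sw_(a, b <- h) F (antipode H a * b) = (counit H h : k) *: F 1.
Proof.
move=> Fl; rewrite -[LHS](tlift_map _ _ Fl) antipodel.
by rewrite -!(linfunP Fl) linearZ.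
Qed.

Lemma sw_antipoder V (F : H -> V) h :
  linear F -> \sw_(a, b <- h) F (a * antipode H b) = (counit H h : k) *: F 1.
Proof.
move=> Fl; rewrite -[LHS](tlift_map _ _ Fl) antipoder.
by rewrite -!(linfunP Fl) linearZ.
Qed.

Lemma sw_mul V (E : H -> H -> V) h x :
  bilin E -> \sw_(a, b <- h * x) E a b =
  \sw_(a, b <- h) \sw_(c, d <- x) E (a * c) (b * d).
Proof.
move=> Eb; rewrite comulM tlift_lin; apply: eq_sw => a b.
by rewrite tlift_lin; apply: eq_sw => c d; rewrite tlift_pure.
Qed.

Lemma sw_one V (E : H -> H -> V) :
  bilin E -> \sw_(a, b <- (1 : H)) E a b = E 1 1.
Proof. by move=> Eb; rewrite comul1 tlift_pure. Qed.

Lemma antipode1 : antipode H 1 = 1.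
Proof.
have := antipodel (1 : H); rewrite sw_one ?mulr1 => [->|]; last by bil.
by rewrite rmorph1 scale1r.
Qed.

(** Both sides are convolution inverse to the multiplication of [H]. Explicitly,
    [S y1 * S x1 * (x2 * y2) * S (x3 * y3)] contracts to the left side when its first four factors
    are cancelled, and to the right side when the last ones are. *)
Lemma antipodeM x y : antipode H (x * y) = antipode H y * antipode H x.
Proof.
pose S := antipode H.
transitivity (\sw_(x1, x2 <- x) \sw_(y1, y2 <- y)
    \sw_(a, b <- x2) \sw_(c, d <- y2) (S y1 * S x1 * ((a * c) * S (b * d)))).
  transitivity (\sw_(x1, x2 <- x) \sw_(a, b <- x2) \sw_(y1, y2 <- y)
      \sw_(c, d <- y2) (S y1 * S x1 * ((a * c) * S (b * d)))); last first.
    by apply: eq_sw => x1 x2; rewrite exchange_tlift.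
  transitivity (\sw_(x1, x2 <- x) \sw_(a, b <- x1) \sw_(y1, y2 <- y)
      \sw_(c, d <- y1) (S c * (S a * b) * (d * S (x2 * y2)))).
    transitivity (\sw_(x1, x2 <- x) (counit H x1 : k) *:
      \sw_(y1, y2 <- y) (counit H y1 : k) *: S (x2 * y2)).
      by rewrite sw_counitl ?sw_counitl //; lin.
    apply: eq_sw => x1 x2.
    transitivity ((counit H x1 : k) *: \sw_(y1, y2 <- y) \sw_(c, d <- y1)
        (S c * 1 * (d * S (x2 * y2)))).
      congr (_ *: _); apply: eq_sw => y1 y2.
      apply: etrans; last first.
        by apply: eq_sw => c d; rewrite mulr1 mulrA.
      by rewrite (sw_antipodel (F := fun u => u * S (x2 * y2))) ?mul1r //; lin.
    by apply: etrans (esym (@sw_antipodel _ (fun u => \sw_(y1, y2 <- y)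
      \sw_(c, d <- y1) S c * u * (d * S (x2 * y2))) x1 _)) _; first by lin.
  apply: etrans (@comul_assoc _ H _ (fun x1 a b => \sw_(y1, y2 <- y)
     \sw_(c, d <- y2) (S y1 * S x1 * ((a * c) * S (b * d)))) x _ _ _);
       last first.
  - by lin.
  - by lin.
  - by lin.
  apply: eq_sw => x1 x2; apply: eq_sw => a b.
  apply: etrans (comul_assoc _ _ _ _); last first.
  - by lin.
  - by lin.
  - by lin.
  by apply: eq_sw => y1 y2; apply: eq_sw => c d; rewrite !mulrA.
transitivity (\sw_(x1, x2 <- x) \sw_(y1, y2 <- y)
  (counit H (x2 * y2) : k) *: (S y1 * S x1)).
  apply: eq_sw => x1 x2; apply: eq_sw => y1 y2.
  transitivity (\sw_(p, q <- x2 * y2) (S y1 * S x1) * (p * S q)).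
    by rewrite sw_mul //; bil.
  rewrite (sw_antipoder (F := fun u => S y1 * S x1 * u)) ?mulr1 //; lin.
transitivity (\sw_(x1, x2 <- x) (counit H x2 : k) *: \sw_(y1, y2 <- y)
  (counit H y2 : k) *: (S y1 * S x1)).
  apply: eq_sw => x1 x2.
  rewrite [RHS]tlift_map; last by lin.
  by apply: eq_sw => y1 y2; rewrite rmorphM scalerA.
by rewrite sw_counitr ?sw_counitr //; lin.
Qed.

End Sweedler.

(** * Integrals and cointegrals *)

Section Cointegral.

Variables (k : fieldType) (H : hopf k).
Implicit Types (V W X : vectType k) (a b c h x y : H).
Local Notation S := (antipode H).

Lemma vbasis_eq V (u v : V) :
  (forall i, coord (vbasis fullv) i u = coord (vbasis fullv) i v) -> u = v.
Proof.
move=> uv; rewrite (coord_vbasis (memvf u)) (coord_vbasis (memvf v)).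
by apply: eq_bigr => i _; rewrite uv.
Qed.

Section RightCointegral.

Variable lam : {linear H -> k^o}.
Hypothesis lamP : right_cointegral lam.

(** Multiplying [b] by [x2 * S x3] changes nothing; after reassociation the cointegral identity
    applies to the product [h * x1] and leaves [S x2]. *)
Lemma right_cointegralM h x :
  \sw_(a, b <- h) (lam (a * x) : k) *: b =
  \sw_(c, d <- x) (lam (h * c) : k) *: S d.
Proof.
transitivity (\sw_(c, d <- x) \sw_(e, g <- d) \sw_(a, b <- h)
    (lam (a * c) : k) *: (b * (e * S g))).
  transitivity (\sw_(c, d <- x) (counit H d : k) *:
      \sw_(a, b <- h) (lam (a * c) : k) *: b).
    by rewrite (sw_counitr (F := fun c => \sw_(a, b <- h)
      (lam (a * c) : k) *: b)) //; lin.
  apply: eq_sw => c d.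
  rewrite (sw_antipoder (F := fun u => \sw_(a, b <- h)
    (lam (a * c) : k) *: (b * u))); last by lin.
  by congr (_ *: _); apply: eq_sw => a b; rewrite mulr1.
apply: etrans (esym (comul_assoc _ _ _ _)) _ => /=.
- by lin.
- by lin.
- by lin.
apply: eq_sw => c d.
transitivity (\sw_(p, q <- h * c) (lam p : k) *: (q * S d)).
  rewrite sw_mul; last by bil.
  rewrite exchange_tlift; apply: eq_sw => e g.
  by apply: eq_sw => a b; rewrite mulrA.
transitivity ((\sw_(p, q <- h * c) (lam p : k) *: q) * S d).
  rewrite (tlift_map (g := fun u => u * S d)); last by lin.
  by apply: eq_sw => p q; rewrite scalerAl.
by rewrite lamP -scalerAl mul1r.
Qed.

Hypothesis lam0 : exists h, lam h != 0.

(** [counit h] times [lam x0] is [lam (h1 * S h2 * x0)]. By [right_cointegralM] the hypothesis kills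
    [lam (h1 * x) h2] for every [x]; expanding [S h2 * x0] in a basis gives terms of this shape. *)
Lemma right_cointegral_counit0 h :
  (forall x, lam (h * x) = 0) -> counit H h = 0.
Proof.
move=> hJ; have [x0 x0P] := lam0.
have e1 x : \sw_(a, b <- h) (lam (a * x) : k) *: b = 0.
  rewrite right_cointegralM tliftE; apply: big1 => i _; apply: big1 => j _.
  by rewrite hJ scale0r scaler0.
have: (counit H h : k) *: lam (1 * x0) = 0.
  rewrite -(@sw_antipoder _ _ _ (fun u => lam (u * x0))); last by lin.
  transitivity (\sum_i \sw_(a, b <- h)
     (coord (vbasis fullv) i (S b * x0) : k) *: lam (a * (vbasis fullv)`_i)).
    rewrite sum_tlift; apply: eq_sw => a b.
    rewrite -mulrA {1}(coord_vbasis (memvf (S b * x0))) mulr_sumr linear_sum.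
    by apply: eq_bigr => i _; rewrite -scalerAr linearZ.
  apply: big1 => i _.
  have Gl : linear (fun u => coord (vbasis fullv) i (S u * x0) : k^o) by lin.
  transitivity (coord (vbasis fullv) i
    (S (\sw_(a, b <- h) (lam (a * (vbasis fullv)`_i) : k) *: b) * x0) : k^o).
    rewrite (tlift_map _ _ Gl); apply: eq_sw => a b.
    by rewrite linearZ -scalerAl linearZ /= [_ *: _]mulrC.
  by rewrite e1 linear0 mul0r linear0.
rewrite mul1r => /eqP; rewrite /GRing.scale /= mulf_eq0 (negPf x0P) orbF.
by move/eqP.
Qed.

(* The [h] with [lam (h * x) = 0] for all [x] form a right ideal and a right
   coideal, so [h1 * S h2] lies in it; as [lam <> 0], the counit vanishes on
   it. *)
Lemma right_cointegral_nondegl h : (forall x, lam (h * x) = 0) -> h = 0.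
Proof.
move=> hJ; suff hp0 (p : {linear H -> k^o}) : p h = 0.
  apply: vbasis_eq => i; rewrite linear0.
  exact: (hp0 (coord (vbasis fullv) i)).
(* This is [h1 p(h2)]: its counit is [p h], and it again satisfies the hypothesis of
   [right_cointegral_counit0]. *)
pose hp := \sw_(a, b <- h) (p b : k) *: a.
have e : counit H hp = p h :> k^o.
  rewrite tlift_map; last by lin.
  transitivity (\sw_(a, b <- h) (counit H a : k) *: (p b : k^o)).
    by apply: eq_sw => a b; rewrite linearZ /= [_ *: _]mulrC.
  by rewrite (sw_counitl (F := fun u => p u : k^o)) //; lin.
apply: etrans (esym e) _; apply: right_cointegral_counit0 => x.
transitivity (p (\sw_(a, b <- h) (lam (a * x) : k) *: b) : k^o).
  rewrite (tlift_map (g := fun u => lam (u * x))); last by lin.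
  rewrite (tlift_map (g := fun u => p u : k^o)); last by lin.
  by apply: eq_sw => a b; rewrite -scalerAl !linearZ /= [_ *: _]mulrC.
rewrite right_cointegralM tliftE big1 ?linear0 // => j _; apply: big1 => l _.
by rewrite hJ scale0r scaler0.
Qed.

(* The Gram matrix of the form [lam (x * y)] is square, so left nondegeneracy
   implies right nondegeneracy. *)
Lemma right_cointegral_nondegr y : (forall x, lam (x * y) = 0) -> y = 0.
Proof.
move=> yJ; pose e := vbasis (fullv : {vspace H}).
have Cl : linear (fun x => \sum_(i < \dim {:H})
  (lam (x * e`_i) : k) *: e`_i) by lin.
pose C := linfun (fun x => \sum_(i < \dim {:H}) (lam (x * e`_i) : k) *: e`_i).
have CE x (i : 'I_(\dim {:H})) : coord e i (C x) = lam (x * e`_i).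
  by rewrite (linfunP Cl) coord_sum_free // (basis_free (vbasisP _)).
have kC : lker C == 0%VS.
  rewrite -subv0; apply/subvP => x; rewrite memv_ker => /eqP Cx0.
  rewrite memv0; apply/eqP/right_cointegral_nondegl => z.
  rewrite (coord_vbasis (memvf z)) mulr_sumr linear_sum big1 // => i _.
  by rewrite -scalerAr linearZ /= -CE Cx0 linear0 scaler0.
apply: vbasis_eq => i; rewrite linear0.
(* [C] is injective, hence surjective by dimension, so some [x] has [lam (x * e_j)] equal to 1 at
   [j = i] and to 0 elsewhere; pairing it with [y] reads off coordinate [i] of [y]. *)
have /memv_imgP[x _ Cx] : e`_i \in limg C by rewrite lker0_limgf ?memvf.
have /= <- := yJ x.
rewrite {2}(coord_vbasis (memvf y)) mulr_sumr linear_sum (bigD1 i) //=.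
rewrite -scalerAr linearZ /= -CE -Cx coord_free ?(basis_free (vbasisP _)) //.
rewrite eqxx [_ *: _]mulr1 big1 ?addr0 // => j ji.
rewrite -scalerAr linearZ /= -CE -Cx coord_free ?(basis_free (vbasisP _)) //.
by rewrite eq_sym (negPf ji) scaler0.
Qed.

(** If [lam L = 0], then [lam (x * L)], which is [counit x] times [lam L], vanishes for all [x],
    against nondegeneracy. *)
Lemma right_cointegral_integral L : left_integral L -> L != 0 -> lam L != 0.
Proof.
move=> LP; apply: contra_neq => lamL.
apply: right_cointegral_nondegr => x.
by rewrite LP linearZ /= lamL scaler0.
Qed.

End RightCointegral.

(** The difference of the two sides is a left integral killed by [lam], hence zero. *)
Lemma left_integral_unique L L' (lam : {linear H -> k^o}) :
  right_cointegral lam -> (exists h, lam h != 0) ->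
  left_integral L -> left_integral L' -> (lam L : k) *: L' = (lam L' : k) *: L.
Proof.
move=> lamP lam0 LP L'P; apply/eqP; rewrite -subr_eq0.
apply: contraT => /(right_cointegral_integral lamP lam0 _) nz.
rewrite -(negPf (nz _)); last first.
  move=> h; rewrite mulrBr -!scalerAr LP L'P scalerBr !scalerA.
  by congr (_ *: _ - _ *: _); rewrite mulrC.
apply/eqP; rewrite linearB 2!linearZ /=; apply: etrans (subrr _).
by congr (_ - _); apply: mulrC.
Qed.

(** Dually, the difference [r] of the two sides is a right cointegral vanishing at the nonzero
    integral [L], hence zero. *)
Lemma right_cointegral_unique L (lam lam' : {linear H -> k^o}) :
  left_integral L -> L != 0 -> right_cointegral lam -> right_cointegral lam' ->
  forall h, (lam L : k) *: lam' h = (lam' L : k) *: lam h.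
Proof.
move=> LP L0 lamP lam'P.
have rl : linear
    (fun h => (lam L : k) *: lam' h - (lam' L : k) *: lam h) by lin.
pose rm := GRing.isLinear.Build _ _ _ _ _ rl.
pose r : {linear H -> k^o} := HB.pack
  (fun h => (lam L : k) *: lam' h - (lam' L : k) *: lam h) rm.
have rE h :
    r h = (lam L : k) * (lam' h : k) - (lam' L : k) * (lam h : k) :> k by [].
have rP : right_cointegral r.
  move=> h; rewrite rE scalerBl -!scalerA -lamP -lam'P.
  rewrite (tlift_map (g := fun u => (lam L : k) *: u)); last by lin.
  rewrite (tlift_map (g := fun u => (lam' L : k) *: u)); last by lin.
  rewrite -scaleN1r addrC -tliftDl; apply: eq_sw => a b.
  by rewrite rE scalerBl -!scalerA scaleN1r addrC.
move=> h; apply/eqP; rewrite -subr_eq0 -[_ - _]/(r h).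
apply: contraT => rh; have := right_cointegral_integral rP
  (ex_intro _ h rh) LP L0.
by rewrite rE mulrC subrr eqxx.
Qed.

Section DualBases.

Variables (lam : {linear H -> k^o}) (L : H).
Hypotheses (lamP : right_cointegral lam) (LP : left_integral L).
Hypothesis lamL : lam L = 1.

Let lam0 : exists h, lam h != 0.
Proof. by exists L; rewrite lamL oner_eq0. Qed.

(** [L1] and [S L2] are dual bases for the form [lam (x * y)]: [right_cointegralM] turns the sum
    into [lam (h1 * L) h2], and [L] is an integral. *)
Lemma dual_basisl h : \sw_(a, b <- L) (lam (h * a) : k) *: S b = h.
Proof.
rewrite -right_cointegralM // -[RHS](sw_counitl (F := id)); last by lin.
by apply: eq_sw => a b; rewrite LP linearZ /= lamL [_ *: 1]mulr1.
Qed.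

Lemma dual_basisr x : \sw_(a, b <- L) (lam (S b * x) : k) *: a = x.
Proof.
apply/eqP; rewrite -subr_eq0; apply/eqP.
apply: (right_cointegral_nondegr lamP lam0) => h.
rewrite mulrBr linearB /=; apply/eqP; rewrite subr_eq0; apply/eqP.
rewrite -[in RHS](dual_basisl h).
rewrite (tlift_map (g := fun u => lam (h * u))); last by lin.
rewrite (tlift_map (g := fun u => lam (u * x))); last by lin.
apply: eq_sw => a b; rewrite -scalerAr -scalerAl !linearZ /=.
by rewrite [_ *: _]mulrC.
Qed.

(** [dual_basisl] writes every element as a value of [S], so [S] is surjective and, in finite
    dimension, bijective. *)
Lemma antipode_bij : exists T : 'End(H), cancel S T /\ cancel T S.
Proof.
have Ssurj : limg S = fullv.
  apply/eqP; rewrite eqEsubv subvf; apply/subvP => h _.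
  rewrite -[h]dual_basisl; set t := (X in X \in _).
  have -> : t = S (\sw_(a, b <- L) (lam (h * a) : k) *: b).
    rewrite tlift_map; last by lin.
    by apply: eq_sw => a b; rewrite linearZ.
  exact: memv_img (memvf _).
have kS : lker S == 0%VS.
  have := limg_ker_dim S fullv; rewrite Ssurj capfv => /eqP.
  by rewrite -[X in _ == X]add0n eqn_add2r dimv_eq0.
exists S^-1%VF; split; [exact: lker0_lfunK | exact: lker0_lfunVK].
Qed.

(* The Nakayama automorphism of [lam], with all antipodes moved to one side so
   that [S^-1] does not occur. *)
Lemma nakayama (alpha : {lrmorphism H -> k^o}) h z :
  (forall x, L * x = (alpha x : k) *: L) ->
  \sw_(a, b <- z) (alpha a : k) *: lam (S (S b) * h) = lam (h * z).
Proof.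
move=> alphaP.
(* This middle term is evaluated twice. Replacing [L * x] by [alpha x *: L] and resumming [h] by
   [dual_basisl] gives the left side. *)
transitivity (\sw_(x, y <- z) \sw_(a, b <- L) \sw_(c, d <- x)
    (lam (h * (a * c)) : k) *: lam (S (S y) * S (b * d))).
  apply: eq_sw => x y.
  transitivity (\sw_(a, b <- L * x) (lam (h * a) : k) *: lam (S (S y) * S b)).
    rewrite alphaP linearZ /= linearZ /= -{1}(dual_basisl h).
    rewrite (tlift_map (g := fun u => lam (S (S y) * u))); last by lin.
    congr (_ *: _); apply: eq_sw => a b.
    by rewrite -scalerAr linearZ.
  by rewrite sw_mul //; bil.
(* With the coproduct of [z] regrouped, [S (S d) * S c] is [S (c * S d)] and contracts to a counit;
   [dual_basisr] at 1 then gives the right side. *)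
rewrite exchange_tlift.
transitivity (\sw_(a, b <- L) (lam (h * (a * z)) : k) *: lam (S b)).
  apply: eq_sw => a b.
  apply: etrans (comul_assoc _ _ _ _) _ => /=.
  - by lin.
  - by lin.
  - by lin.
  transitivity (\sw_(x, y <- z)
      (counit H y : k) *: ((lam (h * (a * x)) : k) *: lam (S b))).
    apply: eq_sw => x y.
    transitivity (\sw_(c, d <- y)
        (lam (h * (a * x)) : k) *: lam (S (c * S d) * S b)).
      by apply: eq_sw => c d; rewrite !antipodeM !mulrA.
    rewrite (sw_antipoder (F := fun u =>
        (lam (h * (a * x)) : k) *: lam (S u * S b))); last by lin.
    by rewrite antipode1 mul1r.
  by rewrite (sw_counitr (F := fun x => (lam (h * (a * x)) : k) *: lam (S b)))
    //; lin.
rewrite -[in RHS](mul1r z) -[in RHS](dual_basisr 1).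
rewrite (tlift_map (g := fun u => lam (h * (u * z)))); last by lin.
by apply: eq_sw => a b; rewrite mulr1 -scalerAl -scalerAr linearZ /=
  [_ *: _]mulrC.
Qed.

End DualBases.
End Cointegral.

(** * Separating tensors by linear functionals *)

Section TensorSeparation.

Variable k : fieldType.
Implicit Types U V W : vectType k.

Lemma pure0l U V (v : V) : pure (0 : U) v = 0.
Proof. by rewrite -[0 in LHS](scale0r 0) pureZl scale0r. Qed.

Lemma pure0r U V (u : U) : pure u (0 : V) = 0.
Proof. by rewrite -[0 in LHS](scale0r 0) pureZr scale0r. Qed.

(** Expand the second leg in a basis: the coefficients are contractions of [t] with coordinate
    functionals. *)
Lemma tensor_eq0l U V (t : tensor U V) :
  (forall xi : {linear V -> k^o}, tlift (fun u v => (xi v : k) *: u) t = 0) ->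
  t = 0.
Proof.
move=> t0; rewrite -[t]tlift_pure_id.
transitivity (\sum_i tlift (fun u v =>
    pure ((coord (vbasis fullv) i v : k) *: u)
      (vbasis (fullv : {vspace V}))`_i) t).
  rewrite sum_tlift; congr (fun_of_lfun _ _); apply: eq_tlift => u v.
  have hl : linear (@pure k U V u) by lin.
  rewrite -(linfunP hl) {1}(coord_vbasis (memvf v)) linear_sum.
  by apply: eq_bigr => i _; rewrite linearZ /= (linfunP hl) pureZl.
apply: big1 => i _.
rewrite -(tlift_map (g := fun u => pure u (vbasis (fullv : {vspace V}))`_i));
  last by lin.
by rewrite t0 pure0l.
Qed.

Lemma tensor_eq0r U V (t : tensor U V) :
  (forall xi : {linear U -> k^o}, tlift (fun u v => (xi u : k) *: v) t = 0) ->
  t = 0.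
Proof.
move=> t0; rewrite -[t]tlift_pure_id.
transitivity (\sum_(i < \dim {:U}) tlift (fun u v =>
    pure (vbasis (fullv : {vspace U}))`_i
      ((coord (vbasis fullv) i u : k) *: v)) t).
  rewrite sum_tlift; congr (fun_of_lfun _ _); apply: eq_tlift => u v.
  have hl : linear (fun u => @pure k U V u v) by lin.
  rewrite -(linfunP hl) {1}(coord_vbasis (memvf u)) linear_sum.
  by apply: eq_bigr => i _; rewrite linearZ /= (linfunP hl) pureZr.
apply: big1 => i _.
rewrite -(tlift_map (g := fun v => pure (vbasis (fullv : {vspace U}))`_i v));
  last by lin.
by rewrite t0 pure0r.
Qed.

End TensorSeparation.

(** * The inverse antipode and convolution with characters *)

Section AntipodeInverse.

Variables (k : fieldType) (H : hopf k).
Implicit Types (V W X : vectType k) (a b c h x y : H).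
Local Notation S := (antipode H).

Variable T : 'End(H).
Hypotheses (SK : cancel S T) (TK : cancel T S).

(** Applying [S], which reverses products, reduces this to the antipode axiom and accounts for the
    swapped legs. *)
Lemma sw_antipodeVr V (F : H -> V) h :
  linear F -> \sw_(a, b <- h) F (b * T a) = (counit H h : k) *: F 1.
Proof.
move=> Fl; rewrite -[LHS](tlift_map _ _ Fl) -!(linfunP Fl) -linearZ /=;
  congr (linfun F _).
apply: (can_inj SK); rewrite linearZ /= antipode1 -antipoder.
rewrite tlift_map; last by lin.
by apply: eq_sw => a b; rewrite antipodeM TK.
Qed.

Lemma sw_antipodeVl V (F : H -> V) h :
  linear F -> \sw_(a, b <- h) F (T b * a) = (counit H h : k) *: F 1.
Proof.
move=> Fl; rewrite -[LHS](tlift_map _ _ Fl) -!(linfunP Fl) -linearZ /=;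
  congr (linfun F _).
apply: (can_inj SK); rewrite linearZ /= antipode1 -antipodel.
rewrite tlift_map; last by lin.
by apply: eq_sw => a b; rewrite antipodeM TK.
Qed.

End AntipodeInverse.

Section Characters.

Variables (k : fieldType) (H : hopf k) (alpha : {lrmorphism H -> k^o}).

(** [alpha] composed with the antipode is a convolution inverse of [alpha], so convolving once more
    recovers [D] from the vanishing sums. *)
Lemma conv_character_inj (V : vectType k) (D : H -> V) z : linear D ->
  (forall z, \sw_(a, b <- z) (alpha a : k) *: D b = 0) -> D z = 0.
Proof.
move=> Dl D0; rewrite -[LHS](sw_counitl _ Dl).
transitivity (\sw_(x, y <- z) \sw_(a, b <- x)
   (alpha (antipode H a * b) : k) *: D y).
  apply: eq_sw => x y.
  rewrite (sw_antipodel (F := fun u => (alpha u : k) *: D y)); last by lin.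
  by rewrite rmorph1 scale1r.
apply: etrans (comul_assoc (E := fun a b y => (alpha (antipode H a * b) : k)
  *: D y) _ _ _ _) _ => /=.
- by lin.
- by lin.
- by lin.
transitivity (\sw_(x, y <- z) 0 : V).
  apply: eq_sw => a y.
  transitivity ((alpha (antipode H a) : k) *: \sw_(b, c <- y)
    (alpha b : k) *: D c).
    rewrite (tlift_map (g := fun u => (alpha (antipode H a) : k) *: u));
      last by lin.
    by apply: eq_sw => b c; rewrite rmorphM scalerA.
  by rewrite D0 scaler0.
by rewrite tliftE big1 // => i _; rewrite big1 // => j _; rewrite scaler0.
Qed.

End Characters.

(** * Bialgebra maps and the relative modular function *)

Section BialgebraMap.

Variables (k : fieldType) (H' H : hopf k) (f : bialg_map H' H).
Implicit Types (V : vectType k).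

Lemma sw_bialg V (E : H -> H -> V) (h : H') : bilin E ->
  \sw_(a, b <- f h) E a b = \sw_(a, b <- h) E (f a) (f b).
Proof.
move=> Eb; rewrite bialg_comul tlift_lin; apply: eq_sw => a b.
by rewrite tlift_pure.
Qed.

(** Both sides are convolution inverses of [f]: [f (S' h1) * f h2 * S (f h3)] contracts to
    either. *)
Lemma bialg_antipode (h : H') : f (antipode H' h) = antipode H (f h).
Proof.
pose S := antipode H; pose S' := antipode H'.
transitivity (\sw_(a, b <- h) \sw_(c, d <- b) (f (S' a) * (f c * S (f d)))).
  rewrite -[LHS](sw_counitr (F := fun u => f (S' u))); last by lin.
  apply: eq_sw => a b; rewrite -(sw_bialg
    (E := fun p q => f (S' a) * (p * S q))); last by bil.
  rewrite (sw_antipoder (F := fun u => f (S' a) * u)); last by lin.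
  by rewrite mulr1 bialg_counit.
apply: etrans (esym (comul_assoc _ _ _ _)) _ => /=.
- by lin.
- by lin.
- by lin.
rewrite -[RHS](sw_counitl (F := fun u => S (f u))); last by lin.
apply: eq_sw => a b.
transitivity (\sw_(c, d <- a) f (S' c * d) * S (f b)).
  by apply: eq_sw => c d; rewrite rmorphM mulrA.
rewrite (sw_antipodel (F := fun u => f u * S (f b))); last by lin.
by rewrite rmorph1 mul1r.
Qed.

(** The relative modular function is the convolution quotient of [alpha'] by [alpha \o f], so it is
    the convolution unit exactly when these characters agree. *)
Lemma rel_modular_trivial (alpha : {lrmorphism H -> k^o})
    (alpha' : {lrmorphism H' -> k^o}) :
  (forall h, rel_modular f alpha alpha' h = counit H' h) <->
  (forall h, alpha (f h) = alpha' h).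
Proof.
split=> [chi h|e h]; last first.
  change (rel_modular f alpha alpha' h = counit H' h :> k^o).
  transitivity (\sw_(a, b <- h) alpha (f (antipode H' a * b))).
    by apply: eq_sw => a b; rewrite -e -bialg_antipode !rmorphM.
  rewrite (sw_antipodel (F := fun u => alpha (f u))); last by lin.
  by rewrite !rmorph1 [_ *: _]mulr1.
transitivity (\sw_(a, b <- h) \sw_(c, d <- b)
    ((alpha (f a) : k) * ((alpha (antipode H (f c)) : k) * (alpha' d : k)) :
      k^o)).
  rewrite -[LHS](sw_counitr (F := fun u => alpha (f u))); last by lin.
  apply: eq_sw => a b; rewrite -chi.
  rewrite -[X in _ = X](tlift_map (g := fun u : k^o => (alpha (f a) : k) *: u))
    /=; last by lin.
  exact: mulrC.
apply: etrans (esym (comul_assoc (E := fun a c d : H' =>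
    ((alpha (f a) : k) * ((alpha (antipode H (f c)) : k) * (alpha' d : k)) :
      k^o)) _ _ _ _)) _ => /=.
- by lin.
- by lin.
- by lin.
rewrite -[RHS](sw_counitl (F := fun u => alpha' u)); last by lin.
apply: eq_sw => a b.
transitivity (\sw_(c, d <- a) (alpha (f (c * antipode H' d)) : k) *: alpha' b).
  apply: eq_sw => c d.
  by rewrite mulrA -bialg_antipode -!rmorphM.
rewrite (sw_antipoder (F := fun u => (alpha (f u) : k) *: alpha' b));
  last by lin.
by rewrite !rmorph1 scale1r.
Qed.

End BialgebraMap.

(** * Frobenius forms *)

Section HopfData.

Variables (k : fieldType) (H : hopf k).

(* An integral and a cointegral normalised against each other; [L] witnesses
   the modular function and [lam] the distinguished grouplike element. *)
Definition integral_pair (alpha : {lrmorphism H -> k^o}) (g : H)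
    (lam : {linear H -> k^o}) (L : H) : Prop :=
  [/\ right_cointegral lam,
    forall h, \sw_(a, b <- h) (lam b : k) *: a = (lam h : k) *: g,
    left_integral L, forall h, L * h = (alpha h : k) *: L & lam L = 1].

(** [lam L] is nonzero, so [L] can be rescaled to make it 1; [alpha] and [g] are insensitive to
    scaling. *)
Lemma integral_pair_exists (alpha : {lrmorphism H -> k^o}) (g : H) :
  modular_function alpha -> distinguished_grouplike g ->
  exists lam L, integral_pair alpha g lam L.
Proof.
move=> [L [L0 LP La]] [lam [lam0 lamP lamg]].
have lamL := right_cointegral_integral lamP lam0 LP L0.
exists lam, ((lam L : k)^-1 *: L); split=> //.
- by move=> h; rewrite -scalerAr LP !scalerA mulrC.
- by move=> h; rewrite -scalerAl La !scalerA mulrC.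
by rewrite linearZ /=; apply: mulVf.
Qed.

End HopfData.

Section Pairing.

Variables (k : fieldType) (H : hopf k) (lam : {linear H -> k^o}).
Hypotheses (lamP : right_cointegral lam) (lam0 : exists h, lam h != 0).

Lemma cointegral_eq u v : (forall x, lam (u * x) = lam (v * x)) -> u = v.
Proof.
move=> uv; apply/eqP; rewrite -subr_eq0; apply/eqP.
apply: (right_cointegral_nondegl lamP lam0) => x.
by rewrite mulrBl linearB /= uv subrr.
Qed.

Lemma cointegral_tensor_eql (V : vectType k) (t u : tensor H V) :
  (forall x, tlift (fun p v => (lam (p * x) : k) *: v) t =
             tlift (fun p v => (lam (p * x) : k) *: v) u) -> t = u.
Proof.
move=> tu; apply/eqP; rewrite -subr_eq0; apply/eqP.
apply: tensor_eq0l => xi; rewrite linearB /=; apply/eqP; rewrite subr_eq0;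
  apply/eqP.
apply: cointegral_eq => x.
have xl : linear (fun v => xi v : k^o) by lin.
have e w : lam (tlift (fun p v => (xi v : k) *: p) w * x) =
    xi (tlift (fun p v => (lam (p * x) : k) *: v) w).
  rewrite (tlift_map (g := fun p => lam (p * x))); last by lin.
  rewrite tlift_map //; congr (fun_of_lfun _ _); apply: eq_tlift => p v.
  by rewrite -scalerAl !linearZ /= [_ *: _]mulrC.
by rewrite !e tu.
Qed.

Lemma cointegral_tensor_eqr (V : vectType k) (t u : tensor V H) :
  (forall x, tlift (fun v p => (lam (p * x) : k) *: v) t =
             tlift (fun v p => (lam (p * x) : k) *: v) u) -> t = u.
Proof.
move=> tu; apply/eqP; rewrite -subr_eq0; apply/eqP.
apply: tensor_eq0r => xi; rewrite linearB /=; apply/eqP; rewrite subr_eq0;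
  apply/eqP.
apply: cointegral_eq => x.
have xl : linear (fun v => xi v : k^o) by lin.
have e w : lam (tlift (fun v p => (xi v : k) *: p) w * x) =
    xi (tlift (fun v p => (lam (p * x) : k) *: v) w).
  rewrite (tlift_map (g := fun p => lam (p * x))); last by lin.
  rewrite tlift_map //; congr (fun_of_lfun _ _); apply: eq_tlift => p v.
  by rewrite -scalerAl !linearZ /= [_ *: _]mulrC.
by rewrite !e tu.
Qed.

End Pairing.

Section FrobeniusForm.

Variables (k : fieldType) (H' H : hopf k) (f : bialg_map H' H).

Record frobenius_form (E : 'Hom(H, H')) : Prop := FrobeniusForm {
  form_l : forall x h, E (f x * h) = x * E h;
  form_r : forall x h, E (h * f x) = E h * x;
  form_nondeg : forall x, (forall h, E (h * x) = 0) -> x = 0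
}.

(** [H'] is an [H]-comodule on either side by pushing one leg of its coproduct along [f]. *)
Definition colinear_l (E : 'Hom(H, H')) : Prop := forall h,
  \sw_(a, b <- h) pure a (E b) = \sw_(a, b <- E h) pure (f a) b.

Definition colinear_r (E : 'Hom(H, H')) : Prop := forall h,
  \sw_(a, b <- h) pure (E a) b = \sw_(a, b <- E h) pure a (f b).

Variables (alpha : {lrmorphism H -> k^o}) (g : H)
  (lam : {linear H -> k^o}) (L : H).
Variables (alpha' : {lrmorphism H' -> k^o}) (g' : H')
  (lam' : {linear H' -> k^o}) (L' : H').
Hypotheses (D : integral_pair alpha g lam L)
  (D' : integral_pair alpha' g' lam' L').

Let lamP : right_cointegral lam. Proof. by case: D. Qed.
Let lam'P : right_cointegral lam'. Proof. by case: D'. Qed.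
Let lam0 : exists h, lam h != 0.
Proof. by case: D => _ _ _ _ e; exists L; rewrite e oner_eq0. Qed.
Let lam'0 : exists h, lam' h != 0.
Proof. by case: D' => _ _ _ _ e; exists L'; rewrite e oner_eq0. Qed.

Lemma form_modular E : frobenius_form E -> forall h, alpha (f h) = alpha' h.
Proof.
move=> [El Er En] h.
case: D => _ _ LP La lamL; case: D' => _ _ L'P L'a lamL'.
have ELP : left_integral (E L) by move=> x; rewrite -El LP bialg_counit linearZ.
(* If [E L = 0], then [E (x * L)], a multiple of [E L], vanishes for all [x], and nondegeneracy
   forces [L = 0]. *)
have EL0 : E L != 0.
  apply/eqP => EL; have L0 : L = 0.
    by apply: En => x; rewrite LP linearZ /= EL scaler0.
  by move/eqP: lamL; rewrite L0 linear0 eq_sym oner_eq0.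
have ELE := left_integral_unique lam'P lam'0 L'P ELP.
rewrite lamL' scale1r in ELE.
have : E L * h = (alpha' h : k) *: E L.
  by rewrite ELE -scalerAl L'a !scalerA mulrC.
rewrite -Er La linearZ /= => /eqP; rewrite -subr_eq0 -scalerBl scaler_eq0.
by rewrite (negPf EL0) orbF subr_eq0 => /eqP.
Qed.

(** The cointegral [lam' \o E] has distinguished grouplike element [f g']; by uniqueness it is a
    multiple of [lam], whose grouplike element is [g]. *)
Lemma form_grouplike E : frobenius_form E -> colinear_l E -> colinear_r E ->
  f g' = g.
Proof.
move=> [El Er En] cl cr.
case: D => _ lamg LP La lamL; case: D' => _ lamg' L'P L'a lamL'.
pose mu : {linear H -> k^o} := (linfun (fun h => lam' (E h)) : 'Hom(H, k^o)).
have muE h : mu h = lam' (E h) by rewrite /= linfunP //; lin.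
have muP : right_cointegral mu.
  move=> h.
  have := congr1 (tlift (fun (p : H') (q : H) => (lam' p : k) *: q)) (cr h).
  rewrite !tlift_lin => e.
  transitivity (\sw_(a, b <- h) (lam' (E a) : k) *: b).
    by apply: eq_sw => a b; rewrite muE.
  transitivity (\sw_(a, b <- E h) (lam' a : k) *: f b).
    transitivity (\sw_(a, b <- h)
        tlift (fun (p : H') (q : H) => (lam' p : k) *: q) (pure (E a) b)).
      by apply: eq_sw => a b; rewrite tlift_pure //; bil.
    by rewrite e; apply: eq_sw => a b; rewrite tlift_pure //; bil.
  transitivity (f (\sw_(a, b <- E h) (lam' a : k) *: b)).
    rewrite tlift_map; last by lin.
    by apply: eq_sw => a b; rewrite linearZ.
  by rewrite lam'P linearZ /= rmorph1 muE.
have mug h : \sw_(a, b <- h) (mu b : k) *: a = (mu h : k) *: f g'.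
  have := congr1 (tlift (fun (p : H) (q : H') => (lam' q : k) *: p)) (cl h).
  rewrite !tlift_lin => e.
  transitivity (\sw_(a, b <- h)
      tlift (fun (p : H) (q : H') => (lam' q : k) *: p) (pure a (E b))).
    by apply: eq_sw => a b; rewrite tlift_pure ?muE //; bil.
  rewrite e; transitivity (f (\sw_(a, b <- E h) (lam' b : k) *: a)).
    rewrite tlift_map; last by lin.
    by apply: eq_sw => a b; rewrite tlift_pure ?linearZ //; bil.
  by rewrite lamg' linearZ muE.
have mulam h : mu h = (mu L : k) *: lam h.
  have L0 : L != 0.
    apply/eqP => L0; move/eqP: lamL.
    by rewrite L0 linear0 eq_sym oner_eq0.
  by rewrite -(right_cointegral_unique LP L0 lamP muP) lamL scale1r.
(* Otherwise [mu = 0], so [lam' (E h * x) = mu (h * f x)] always vanishes, [E = 0], and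
   nondegeneracy would give [1 = 0]. *)
have muL0 : (mu L : k) != 0.
  apply/eqP => muL; have /eqP : (1 : H) = 0.
    apply: En => h; apply: (right_cointegral_nondegl lam'P lam'0) => x.
    by rewrite -Er -muE mulam muL scale0r.
  by rewrite oner_eq0.
apply: (scalerI muL0); rewrite -mug.
transitivity (\sw_(a, b <- L) (mu L : k) *: ((lam b : k) *: a)).
  by apply: eq_sw => a b; rewrite mulam scalerA.
rewrite -(tlift_map (g := fun a => (mu L : k) *: a)); last by lin.
by rewrite lamg lamL scale1r.
Qed.

(* [E] is the adjoint of [f] for the pairings given by [lam'] and [lam]. *)
Lemma form_exists : exists E : 'Hom(H, H'),
  [/\ forall h x, lam' (E h * x) = lam (h * f x),
      forall x h, E (h * f x) = E h * x,
      forall x, (forall h, E (h * x) = 0) -> x = 0 & colinear_r E].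
Proof.
case: D' => _ _ L'P _ lamL'.
(* The formula is forced by adjointness: expand [E h] in the dual bases [L'1], [S L'2] of [lam'] and
   replace [lam' (E h * L'1)] by [lam (h * f L'1)]. *)
have El : linear (fun h => \sw_(a, b <- L')
  (lam (h * f a) : k) *: antipode H' b) by lin.
pose E : 'Hom(H, H') := linfun (fun h => \sw_(a, b <- L')
  (lam (h * f a) : k) *: antipode H' b).
have lamE h x : lam' (E h * x) = lam (h * f x).
  rewrite (linfunP El) (tlift_map (g := fun u => lam' (u * x))); last by lin.
  rewrite -[x in RHS](dual_basisr lam'P L'P lamL').
  rewrite (tlift_map (g := fun u => lam (h * f u))); last by lin.
  by apply: eq_sw => a b; rewrite linearZ -scalerAl -scalerAr !linearZ /=
    [_ *: _]mulrC.
exists E; split=> //.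
- move=> x h; apply: (cointegral_eq lam'P lam'0) => y.
  by rewrite -mulrA !lamE rmorphM mulrA.
- move=> x E0; apply: (right_cointegral_nondegr lamP lam0) => h.
  by have := lamE (h * x) 1; rewrite E0 mul0r linear0 rmorph1 mulr1.
(* Right colinearity, tested by pairing the first leg with [x]: [right_cointegralM] in [H] and in
   [H'] turns both sides into [lam (h * f x1) S (f x2)]. *)
move=> h; apply: (cointegral_tensor_eql lam'P lam'0) => x.
rewrite !tlift_lin.
transitivity (\sw_(a, b <- h) (lam (a * f x) : k) *: b).
  by apply: eq_sw => a b; rewrite tlift_pure ?lamE //; bil.
transitivity (f (\sw_(a, b <- E h) (lam' (a * x) : k) *: b)).
  rewrite !right_cointegralM // tlift_map; last by lin.
  rewrite sw_bialg; last by bil.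
  by apply: eq_sw => a b; rewrite lamE linearZ /= bialg_antipode.
rewrite tlift_map; last by lin.
by apply: eq_sw => a b; rewrite tlift_pure ?linearZ //; bil.
Qed.

Hypothesis alpha_f : forall h, alpha (f h) = alpha' h.

(** After pairing with [y] through [lam'], the factor [x] has to cross to the right in [H] and back
    to the left in [H']. The two Nakayama rules do this with twists by [alpha \o f] and [alpha'],
    which agree; [conv_character_inj] removes the common twist. *)
Lemma form_left_linear (E : 'Hom(H, H')) :
  (forall h x, lam' (E h * x) = lam (h * f x)) ->
  forall x h, E (f x * h) = x * E h.
Proof.
case: D => _ _ LP La lamL; case: D' => _ _ L'P L'a lamL' lamE x h.
have [T [_ TK]] := antipode_bij lam'P L'P lamL'.
(* [nakayama] is phrased with [S (S b)], so [x] is first written as a double antipode. *)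
pose S := antipode H'; rewrite -[x]TK -[T x]TK; move: (T (T x)) => {}x.
apply/eqP; rewrite -subr_eq0; apply/eqP.
pose Df u := E (f (S (S u)) * h) - S (S u) * E h.
apply: (@conv_character_inj _ _ alpha' _ Df); first by rewrite /Df; lin.
move=> z; apply: (right_cointegral_nondegl lam'P lam'0) => y.
have bl (F : H' -> H') : linear F ->
  lam' ((\sw_(a, b <- z) (alpha' a : k) *: F b) * y) =
   \sw_(a, b <- z) (alpha' a : k) *: lam' (F b * y).
  move=> Fl; rewrite (tlift_map (g := fun u => lam' (u * y))); last by lin.
  by apply: eq_sw => a b; rewrite -scalerAl linearZ.
rewrite bl; last by rewrite /Df; lin.
transitivity ((\sw_(a, b <- z) (alpha' a : k) *: lam'
  (E (f (S (S b)) * h) * y)) -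
  (\sw_(a, b <- z) (alpha' a : k) *: lam' (S (S b) * E h * y))).
  rewrite -[X in _ - X]scale1r -scaleNr addrC -tliftDl; apply: eq_sw => a b.
  by rewrite mulrBl linearB scalerBr scaleN1r addrC.
apply/eqP; rewrite subr_eq0; apply/eqP.
transitivity (lam' (E h * y * z)).
  rewrite -mulrA lamE rmorphM mulrA -(nakayama lamP LP lamL _ _ La).
  rewrite sw_bialg; last by bil.
  by apply: eq_sw => a b; rewrite alpha_f lamE !bialg_antipode mulrA.
rewrite -(nakayama lam'P L'P lamL' _ _ L'a).
by apply: eq_sw => a b; rewrite mulrA.
Qed.

(** The grouplike elements contract one leg of a whole product such as [h * f y]. This yields the
    desired identity twisted by [f y1], and the inverse antipode of [H'] removes the twist. *)
Lemma form_colinear_l (E : 'Hom(H, H')) : f g' = g ->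
  (forall h x, lam' (E h * x) = lam (h * f x)) -> colinear_l E.
Proof.
move=> gg lamE h.
case: D => _ lamg LP La lamL; case: D' => _ lamg' L'P L'a lamL'.
have [T [SK TK]] := antipode_bij lam'P L'P lamL'.
apply: (cointegral_tensor_eqr lam'P lam'0) => x; rewrite !tlift_lin.
pose A y := \sw_(a, b <- h) (lam (b * f y) : k) *: a.
pose B y := \sw_(a, b <- E h) (lam' (b * y) : k) *: f a.
transitivity (A x).
  by apply: eq_sw => a b; rewrite tlift_pure ?lamE //; bil.
transitivity (B x); last first.
  by apply: eq_sw => a b; rewrite tlift_pure //; bil.
pose Df y := A y - B y; have Dfl : linear Df by rewrite /Df /A /B; lin.
apply/eqP; rewrite -subr_eq0; apply/eqP; rewrite -[LHS]/(Df x).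
(* The sums for [A] and [B] are [lam (h * f y) *: g] and [lam' (E h * y) *: f g'], equal by [lamE]
   and [gg]. *)
have Df0 y : \sw_(c, d <- y) Df d * f c = 0.
  transitivity (\sw_(c, d <- y) A d * f c - \sw_(c, d <- y) B d * f c).
    rewrite -[X in _ - X]scale1r -scaleNr addrC -tliftDl; apply: eq_sw => a b.
    by rewrite mulrBl scaleN1r addrC.
  apply/eqP; rewrite subr_eq0; apply/eqP.
  transitivity ((lam (h * f y) : k) *: g).
    rewrite -lamg sw_mul; last by bil.
    rewrite exchange_tlift sw_bialg; last by bil.
    apply: eq_sw => c d; rewrite /A (tlift_map (g := fun u => u * f c));
      last by lin.
    by apply: eq_sw => a b; rewrite scalerAl.
  rewrite -gg -lamE -linearZ -lamg' sw_mul; last by bil.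
  rewrite exchange_tlift tlift_map; last by lin.
  apply: eq_sw => c d; rewrite /B tlift_map; last by lin.
  rewrite (tlift_map (g := fun u => u * f c)); last by lin.
  by apply: eq_sw => a b; rewrite linearZZ rmorphM scalerAl.
rewrite -[LHS](sw_counitl _ Dfl).
(* Since [q * T p] contracts to a counit, [Df x] is recovered from the vanishing sums of [Df0]
   multiplied by [f (T p)]. *)
transitivity (\sw_(c, d <- x) \sw_(p, q <- c) Df d * f q * f (T p)).
  apply: eq_sw => c d.
  transitivity (\sw_(p, q <- c) Df d * f (q * T p)).
    by rewrite (sw_antipodeVr SK TK (F := fun u => Df d * f u)) ?rmorph1 ?mulr1
      //; lin.
  by apply: eq_sw => p q; rewrite rmorphM mulrA.
apply: etrans (comul_assoc (E := fun p q d => Df d * f q * f (T p)) _ _ _ _)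
  _ => /=.
- by lin.
- by lin.
- by lin.
transitivity (\sw_(p, y <- x) (0 : H)).
  apply: eq_sw => p y.
  rewrite -(tlift_map (g := fun u => u * f (T p))); last by lin.
  by rewrite Df0 mul0r.
by rewrite tliftE big1 // => i _; rewrite big1 // => j _; rewrite scaler0.
Qed.

End FrobeniusForm.

(** * Restriction and its right adjoint *)

Section RepMorphisms.

Variables (k : fieldType) (H : hopf k).
Implicit Types X Y Z : rep H.

Definition ap X Y (g : rep_mor H X Y) : 'Hom(X, Y) := rep_hom_fun g.

Lemma ap_comp X Y Z (g : rep_mor H Y Z)
  (h : rep_mor H X Y) x : ap (g \oc h) x = ap g (ap h x).
Proof. by rewrite [LHS]comp_lfunE. Qed.

Lemma ap_id X x : ap (@idm k (rep_category H) X) x = x.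
Proof. by rewrite [LHS]id_lfunE. Qed.

Lemma ap_act X Y (g : rep_mor H X Y) h x :
  ap g (rep_act X h x) = rep_act Y h (ap g x).
Proof. exact: rep_homE. Qed.

Lemma ap_ext X Y (g h : rep_mor H X Y) :
  (forall x, ap g x = ap h x) -> g = h.
Proof. by move=> gh; apply: rep_homP_eq. Qed.

Lemma ap0 X Y x : ap (0 : rep_mor H X Y) x = 0.
Proof. by rewrite [LHS]zero_lfunE. Qed.

Definition mkhom X Y (g : 'Hom(X, Y))
    (gP : forall h v, g (rep_act X h v) = rep_act Y h (g v)) :
  rep_mor H X Y := RepHom (intertwinerP gP).

Lemma rep_actMv X a b (x : X) : rep_act X (a * b) x =
    rep_act X a (rep_act X b x).
Proof. by rewrite rep_actM comp_lfunE. Qed.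

Lemma rep_act1v X (x : X) : rep_act X 1 x = x.
Proof. by rewrite rep_act1 id_lfunE. Qed.

Fact regular_rep1 : linfun (@amull k H) 1 = \1%VF.
Proof. by rewrite lfunE /= amull1. Qed.

Fact regular_repM a b :
  linfun (@amull k H) (a * b) = (linfun (@amull k H) a \o linfun
    (@amull k H) b)%VF.
Proof. by apply/lfunP => x; rewrite comp_lfunE !lfunE /= mulrA. Qed.

Definition regular_rep : rep H := Rep regular_rep1 regular_repM.

Lemma regular_repE a (b : H) : rep_act regular_rep a b = a * b.
Proof. by rewrite /= !lfunE. Qed.

Fact orbit_subproof X (x : X) :
  forall h a, linfun (fun b : H => rep_act X b x) (rep_act regular_rep h a) =
    rep_act X h (linfun (fun b : H => rep_act X b x) a).
Proof.
move=> h a; have l : linear (fun b : H => rep_act X b x) by lin.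
by rewrite !(linfunP l) regular_repE rep_actMv.
Qed.

Definition orbit_mor X (x : X) : rep_mor H regular_rep X :=
  mkhom (orbit_subproof x).

Lemma orbit_morE X (x : X) a : ap (orbit_mor x) a = rep_act X a x.
Proof. by rewrite [LHS]linfunP //; lin. Qed.

End RepMorphisms.

Section Restriction.

Variables (k : fieldType) (H' H : hopf k) (f : bialg_map H' H).

Lemma res_rep_actE (V : rep H) (h : H') (v : V) :
  rep_act (res_rep f V) h v = rep_act V (f h) v.
Proof. exact: (congr1 (fun u : 'End(V) => u v) (res_actE f V h)). Qed.

Section RightAdjoint.

Variables (R : functor (rep_category H') (rep_category H))
  (aR : adjunction (res_functor f) R).
Implicit Types V W : rep H'.

Definition rsp V : rep H := R V.

(* [R V] is a copy of [Hom_H' (H, V)]: the element [r] stands for [cev r], and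
   [cmk] inverts [cev]. *)
Definition cev V (r : rsp V) (h : H) : V :=
    ap (adj_counit aR V) (rep_act (rsp V) h r).

Lemma cev_linl V h : linear (fun r : rsp V => cev r h).
Proof. by rewrite /cev; lin. Qed.

Lemma cev_linr V (r : rsp V) : linear (cev r).
Proof. by rewrite /cev; lin. Qed.

Lemma cevZ V (a : k) (r : rsp V) h : cev (a *: r) h = a *: cev r h.
Proof. by rewrite /cev !linearZ. Qed.

Lemma cev_act V (r : rsp V) a h : cev (rep_act (rsp V) a r) h = cev r (h * a).
Proof. by rewrite /cev rep_actMv. Qed.

Lemma cev_res V (r : rsp V) x h : cev r (f x * h) = rep_act V x (cev r h).
Proof.
by rewrite /cev rep_actMv -ap_act; congr (ap _ _); rewrite res_rep_actE.
Qed.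

Lemma cev_fmap V W (g : rep_mor H' V W) (r : rsp V) h :
  cev (ap (fmap R g) r : rsp W) h = ap g (cev r h).
Proof.
rewrite /cev -ap_comp -(adj_counit_nat aR) ap_comp; congr (ap _ _).
exact: (esym (ap_act (fmap R g) h r)).
Qed.

Lemma cev_unit (X : rep H) (t : X) h :
  cev (ap (adj_unit aR X) t : rsp (res_rep f X)) h = rep_act X h t.
Proof.
rewrite /cev -ap_act.
have := adj_trianglel aR X.
move/(congr1 (fun u : rep_mor H' (res_rep f X)
  (res_rep f X) => ap u (rep_act X h t))); rewrite ap_id => {2}<-.
by rewrite ap_comp.
Qed.

Fact cmk_subproof V (phi : 'Hom(H, V)) :
  (forall x h, phi (f x * h) = rep_act V x (phi h)) ->
  forall x (h : res_rep f (regular_rep H)),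
    phi (rep_act (res_rep f (regular_rep H)) x h) = rep_act V x (phi h).
Proof. by move=> phiP x h; rewrite res_rep_actE regular_repE phiP. Qed.

(** An [H]-morphism from the regular representation to [R V] is fixed by its value at 1; this is
    that value for the adjunct of [g]. *)
Definition transpose V (g : rep_mor H' (res_rep f (regular_rep H)) V) : rsp V :=
  ap (fmap R g) (ap (adj_unit aR (regular_rep H)) 1).

Lemma cev_transpose V (g : rep_mor H' (res_rep f (regular_rep H)) V) h :
  cev (transpose g) h = ap g h.
Proof.
by rewrite cev_fmap cev_unit regular_repE mulr1.
Qed.

(** By a triangle identity each [q] is the transpose of the morphism [h |-> cev q h], hence is
    determined by it. *)
Lemma cev_inj V (r s : rsp V) : (forall h, cev r h = cev s h) -> r = s.
Proof.
have tr (q : rsp V) : q = transpose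
  (adj_counit aR V \oc fmap (res_functor f) (orbit_mor q)).
  rewrite /transpose fmapM ap_comp.
  have := adj_unit_nat aR (orbit_mor q).
  move/(congr1 (fun u : rep_mor H (regular_rep H)
    (R (res_functor f (rsp V))) => ap u 1)).
  rewrite !ap_comp orbit_morE rep_act1v => <-.
  by rewrite -ap_comp adj_triangler ap_id.
move=> rs; rewrite [r]tr [s]tr; congr (transpose _); apply: ap_ext => h.
rewrite !ap_comp.
have e (q : rsp V) : ap (fmap (res_functor f) (orbit_mor q)) h =
  rep_act (rsp V) h q.
  exact: (orbit_morE q h).
rewrite !e; exact: rs.
Qed.

Definition cmk V (phi : 'Hom(H, V))
    (phiP : forall x h, phi (f x * h) = rep_act V x (phi h)) : rsp V :=
  transpose (mkhom (cmk_subproof phiP)).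

Lemma cev_cmk V (phi : 'Hom(H, V)) phiP h : cev (@cmk V phi phiP) h = phi h.
Proof. exact: cev_transpose. Qed.

End RightAdjoint.
End Restriction.

(** * Exactness of the right adjoint and dual bases *)

Section Subrep.

Variables (k : fieldType) (H : hopf k) (V : rep H) (U : {vspace V}).
Hypothesis stU : forall h v, v \in U -> rep_act V h v \in U.

Let sub_act_fun (h : H) : 'End(subvs_of U) :=
  (linfun (vsproj U) \o (rep_act V h \o linfun vsval))%VF.

Fact sub_act_lin : linear sub_act_fun.
Proof.
by move=> c x y; rewrite /sub_act_fun linearP comp_lfunDl comp_lfunDr
  -comp_lfunZl -comp_lfunZr.
Qed.

Definition sub_act : 'Hom(H, 'End(subvs_of U)) := linfun sub_act_fun.

Lemma sub_actE h u : vsval (sub_act h u) = rep_act V h (vsval u).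
Proof.
rewrite (linfunP sub_act_lin) !comp_lfunE !lfunE /= vsprojK //.
exact/stU/subvsP.
Qed.

Fact sub_act1 : sub_act 1 = \1%VF.
Proof.
by apply/lfunP => u; apply: val_inj; rewrite /= sub_actE rep_act1v id_lfunE.
Qed.

Fact sub_actM a b : sub_act (a * b) = (sub_act a \o sub_act b)%VF.
Proof.
by apply/lfunP => u; apply: val_inj; rewrite /= comp_lfunE !sub_actE rep_actMv.
Qed.

Definition subrep : rep H := Rep sub_act1 sub_actM.

Fact subrep_incl_subproof :
  forall h v, linfun (@vsval k V U) (rep_act subrep h v) =
    rep_act V h (linfun (@vsval k V U) v).
Proof. by move=> h v; rewrite !lfunE /= sub_actE. Qed.

Definition subrep_incl : rep_mor H subrep V :=
  @mkhom _ _ subrep V _ subrep_incl_subproof.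

Lemma subrep_inclE u : ap subrep_incl u = vsval u.
Proof. by rewrite [LHS]lfunE. Qed.

End Subrep.

Section SurjectiveExact.

Variables (k : fieldType) (H : hopf k).

Lemma ker_stable (X Y : rep H) (p : rep_mor H X Y) :
  forall h v, v \in lker (ap p) -> rep_act X h v \in lker (ap p).
Proof. by move=> h v; rewrite !memv_ker ap_act => /eqP->; rewrite linear0. Qed.

Lemma surjective_short_exact (X Y : rep H) (p : rep_mor H X Y) :
  (forall y, exists x, ap p x = y) ->
  short_exact (subrep_incl (ker_stable (p := p))) p.
Proof.
move=> surj; set i := subrep_incl _.
have pi0 : p \oc i = 0.
  apply: ap_ext => u; rewrite ap_comp subrep_inclE ap0; apply/eqP.
  by rewrite -memv_ker subvsP.
split; split=> // T t t0.
  have tk x : ap t x \in lker (ap p).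
    by rewrite memv_ker -ap_comp t0 ap0.
  pose u := (linfun (vsproj (lker (ap p))) \o ap t)%VF.
  have uE x : vsval (u x) = ap t x.
    by rewrite comp_lfunE lfunE /= vsprojK.
  have uP h x : u (rep_act T h x) =
    rep_act (subrep (ker_stable (p := p))) h (u x).
    by apply: val_inj; rewrite /= sub_actE ?uE ?ap_act //; exact: ker_stable.
  exists (@mkhom _ _ T (subrep (ker_stable (p := p))) _ uP); split.
    by apply: ap_ext => x; rewrite ap_comp subrep_inclE uE.
  move=> u' u'E; apply: ap_ext => x; apply: val_inj.
  by rewrite /= uE -u'E ap_comp subrep_inclE.
have tker x : ap p x = 0 -> ap t x = 0.
  move=> px; have xk : x \in lker (ap p) by rewrite memv_ker px.
  have <- : ap i (vsproj _ x) = x by rewrite subrep_inclE vsprojK.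
  by rewrite -ap_comp t0 ap0.
have teq x y : ap p x = ap p y -> ap t x = ap t y.
  move=> pxy; apply/eqP; rewrite -subr_eq0 -linearB; apply/eqP/tker.
  by rewrite linearB /= pxy subrr.
(* [(ap p)^-1] is only a linear section, but [t] kills the kernel of [p], so [u] factors [t] through
   [p] and is [H]-linear. *)
pose u := (ap t \o (ap p)^-1)%VF.
have pK y : ap p ((ap p)^-1%VF y) = y.
  by apply: limg_lfunVK; have [x <-] := surj y; apply: memv_img (memvf _).
have uE x : u (ap p x) = ap t x.
  by rewrite comp_lfunE; apply: teq; rewrite pK.
have uP h y : u (rep_act Y h y) = rep_act T h (u y).
  by have [x <-] := surj y; rewrite -ap_act !uE ap_act.
exists (@mkhom _ _ Y T _ uP); split.
  by apply: ap_ext => x; rewrite ap_comp [LHS]uE.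
move=> u' u'E; apply: ap_ext => y; have [x <-] := surj y.
by rewrite [LHS]uE -u'E ap_comp.
Qed.

Let dual_act_fun (h : H) : 'End('Hom(H, k^o)) :=
  linfun (fun phi : 'Hom(H, k^o) => (phi \o amulr h)%VF).

Fact dual_act_fun_lin h : linear (fun phi : 'Hom(H,
    k^o) => (phi \o amulr h)%VF).
Proof. by move=> c x y; rewrite comp_lfunDl -comp_lfunZl. Qed.

Fact dual_act_lin : linear dual_act_fun.
Proof.
move=> c x y; apply/lfunP => phi.
rewrite add_lfunE scale_lfunE !(linfunP (@dual_act_fun_lin _)).
by rewrite linearP comp_lfunDr -comp_lfunZr.
Qed.

Definition dual_act : 'Hom(H, 'End('Hom(H, k^o))) := linfun dual_act_fun.

Lemma dual_actE h phi x : dual_act h phi x = phi (x * h).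
Proof.
rewrite (linfunP dual_act_lin) (linfunP (@dual_act_fun_lin _)).
by rewrite comp_lfunE lfunE.
Qed.

Fact dual_act1 : dual_act 1 = \1%VF.
Proof. by do 2![apply/lfunP => ?]; rewrite dual_actE mulr1 id_lfunE. Qed.

Fact dual_actM a b : dual_act (a * b) = (dual_act a \o dual_act b)%VF.
Proof. by do 2![apply/lfunP => ?]; rewrite comp_lfunE !dual_actE mulrA. Qed.

Definition dual_rep : rep H := Rep dual_act1 dual_actM.

(* A linear functional [xi] on [Y] extends to the morphism
   [y |-> (h |-> xi (h y))] into the dual of the regular representation, so
   these test objects detect the image of a morphism. *)
Lemma epi_surjective (X Y : rep H) (g : rep_mor H X Y) :
  (forall (T : rep H) (u : rep_mor H Y T), u \oc g = 0 -> u = 0) ->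
  forall y, exists x, ap g x = y.
Proof.
move=> epi y; suff /memv_imgP[x _ ->] : y \in limg (ap g) by exists x.
(* A projection with kernel the image of [g]; the coordinates of [q] are the functionals fed to the
   dual representation. *)
pose q := (\1 - projv (limg (ap g)))%VF.
suff qy : q y = 0.
  have -> : y = projv (limg (ap g)) y.
    by apply/eqP; rewrite -subr_eq0 -{1}[y]id_lfunE -opp_lfunE -add_lfunE qy.
  exact: memv_proj.
have qim x : q (ap g x) = 0.
  rewrite add_lfunE opp_lfunE id_lfunE projv_id ?subrr //.
  exact: memv_img (memvf _).
apply: vbasis_eq => i; rewrite linear0.
pose xi z := coord (vbasis fullv) i (q z) : k^o.
have xil : linear xi by rewrite /xi; lin.
have ul z : linear (fun h => xi (rep_act Y h z)) by rewrite /xi; lin.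
pose u z : 'Hom(H, k^o) := linfun (fun h => xi (rep_act Y h z)).
have uE z h : u z h = xi (rep_act Y h z) by rewrite (linfunP (ul z)).
have uL : linear u.
  move=> c z w; apply/lfunP => h; rewrite add_lfunE scale_lfunE !uE.
  by rewrite linearP xil.
have uP h z : linfun u (rep_act Y h z) = rep_act dual_rep h (linfun u z).
  apply/lfunP => x; rewrite !(linfunP uL) /= dual_actE !uE.
  by rewrite rep_actMv.
have u0 : @mkhom _ _ Y dual_rep _ uP = 0.
  apply: epi; apply: ap_ext => x; rewrite ap_comp ap0.
  apply/lfunP => h; rewrite zero_lfunE [ap _ _](linfunP uL) uE -ap_act /xi.
  by rewrite qim linear0.
have : u y 1 = 0.
  by rewrite -(linfunP uL) -[linfun u y]/(ap (@mkhom _ _ Y dual_rep _ uP) y) u0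
    ap0 zero_lfunE.
by rewrite uE rep_act1v.
Qed.

End SurjectiveExact.

Section FreeRep.

Variables (k : fieldType) (H : hopf k) (n : nat).

Let free_act_fun (h : H) : 'End({ffun 'I_n -> H}) :=
  linfun (fun psi : {ffun 'I_n -> H} => [ffun i => h * psi i]).

Fact free_act_fun_lin h : linear (fun psi : {ffun 'I_n -> H} =>
    [ffun i => h * psi i]).
Proof.
by move=> c x y; apply/ffunP => i; rewrite !ffunE mulrDr scalerAr.
Qed.

Fact free_act_lin : linear free_act_fun.
Proof.
move=> c x y; apply/lfunP => psi.
rewrite add_lfunE scale_lfunE !(linfunP (@free_act_fun_lin _)).
by apply/ffunP => i; rewrite !ffunE mulrDl scalerAl.
Qed.

Definition free_act : 'Hom(H, 'End({ffun 'I_n -> H})) := linfun free_act_fun.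

Lemma free_actE h psi i : free_act h psi i = h * psi i.
Proof.
by rewrite (linfunP free_act_lin) (linfunP (@free_act_fun_lin _)) ffunE.
Qed.

Fact free_act1 : free_act 1 = \1%VF.
Proof.
by apply/lfunP => psi; apply/ffunP => i; rewrite free_actE mul1r id_lfunE.
Qed.

Fact free_actM a b : free_act (a * b) = (free_act a \o free_act b)%VF.
Proof.
by apply/lfunP => psi; apply/ffunP => i; rewrite comp_lfunE !free_actE mulrA.
Qed.

Definition free_rep : rep H := Rep free_act1 free_actM.

End FreeRep.

Section DualBasis.

Variables (k : fieldType) (H' H : hopf k) (f : bialg_map H' H).

(** Exactness makes [R] preserve the surjection [p] from a free module onto [H]. As [R V] stands for
    [Hom_H' (H, V)], lifting the element that represents the identity of [H] yields an [H']-linear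
    section of [p], whose components are the [phi i]. *)
Lemma perfect_dual_basis : perfect_functor (res_functor f) ->
  exists n (phi : 'I_n -> 'Hom(H, H')) (y : 'I_n -> H),
    (forall i x h, phi i (f x * h) = x * phi i h) /\
    (forall h, \sum_i f (phi i h) * y i = h).
Proof.
case=> R [aR] Rex.
pose n := \dim {:H}; pose e := vbasis (fullv : {vspace H}).
pose P := free_rep H' n; pose FH := res_rep f (regular_rep H).
have pl : linear (fun psi : {ffun 'I_n -> H'} => \sum_(i < n) f (psi i) * e`_i).
  move=> c x y; rewrite scaler_sumr -big_split /=; apply: eq_bigr => i _.
  by rewrite !ffunE linearP mulrDl scalerAl.
have pP h (psi : P) : linfun (fun psi : {ffun 'I_n -> H'} => \sum_(i < n) f
  (psi i) * e`_i : FH)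
    (rep_act P h psi) = rep_act FH h
      (linfun (fun psi : {ffun 'I_n -> H'} => \sum_(i < n) f
        (psi i) * e`_i : FH) psi).
  rewrite !(linfunP pl) res_rep_actE regular_repE mulr_sumr.
  by apply: eq_bigr => i _; rewrite free_actE rmorphM mulrA.
pose p : rep_mor H' P FH := @mkhom _ _ P FH _ pP.
have pE psi : ap p psi = \sum_(i < n) f ((psi : {ffun 'I_n -> H'}) i) * e`_i.
  by rewrite [LHS](linfunP pl).
have psurj z : exists psi, ap p psi = z.
  exists [ffun i => coord e i z *: 1]; rewrite pE.
  rewrite [RHS](coord_vbasis (memvf (z : H))); apply: eq_bigr => i _.
  by rewrite ffunE linearZ rmorph1 -scalerAl mul1r.
have [_ [_ coker]] := Rex _ _ _ _ _ (surjective_short_exact psurj).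
have epi (T : rep H) (u : rep_mor H (R FH) T) : u \oc fmap R p = 0 -> u = 0.
  move=> up; have [|v [_ vu]] := coker T 0.
    by apply: ap_ext => x; rewrite ap_comp !ap0.
  rewrite -(vu u up) (vu 0) //.
  by apply: ap_ext => x; rewrite ap_comp !ap0.
have [s sE] := epi_surjective epi (transpose aR (@idm _ (rep_category H') FH)).
have sl i : linear (fun h => (cev aR s h : {ffun 'I_n -> H'}) i).
  by move=> c x y; rewrite cev_linr !ffunE.
exists n, (fun i => linfun (fun h => (cev aR s h : {ffun 'I_n -> H'}) i)),
  (fun i => e`_i).
split=> [i x h|h].
  by rewrite !(linfunP (sl i)) cev_res free_actE.
transitivity (ap p (cev aR s h)).
  by rewrite pE; apply: eq_bigr => i _; rewrite (linfunP (sl i)).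
by rewrite -cev_fmap sE cev_transpose ap_id.
Qed.

End DualBasis.

(** * The right adjoint as a left adjoint *)

Section IdentityIso.

Variables (k : fieldType) (C D : category k) (F : functor C D).

Definition id_iso (X : D) : iso X X := Iso (comp1m (idm X)) (comp1m (idm X)).

Fact id_nat_subproof (X Y : C) (g : Defs.hom X Y) :
  id_iso (F Y) \oc fmap F g = fmap F g \oc id_iso (F X).
Proof. by rewrite comp1m compm1. Qed.

Definition id_nat_iso : nat_iso F F := NatIso id_nat_subproof.

End IdentityIso.

Section FrobeniusSystem.

Variables (k : fieldType) (H' H : hopf k) (f : bialg_map H' H).

Record frobenius_system (E : 'Hom(H, H')) n (x y : 'I_n -> H) : Prop :=
  FrobeniusSystem {
    system_form : frobenius_form f E;
    system_l : forall h, \sum_i f (E (h * x i)) * y i = h;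
    system_r : forall h, \sum_i x i * f (E (y i * h)) = h
  }.

(** The [y i] come from projectivity. By nondegeneracy of [lam], each functional [lam' \o phi i] is
    [lam (h * x i)] for some [x i], and this forces [phi i h = E (h * x i)]. *)
Lemma frobenius_system_exists (alpha : {lrmorphism H -> k^o}) (g : H)
    (lam : {linear H -> k^o}) (L : H) (alpha' : {lrmorphism H' -> k^o})
    (g' : H') (lam' : {linear H' -> k^o}) (L' : H') :
  integral_pair alpha g lam L -> integral_pair alpha' g' lam' L' ->
  (forall h, alpha (f h) = alpha' h) -> perfect_functor (res_functor f) ->
  exists E n (x y : 'I_n -> H),
    [/\ frobenius_system E x y, colinear_r f E & f g' = g -> colinear_l f E].
Proof.
move=> D D' alpha_f /perfect_dual_basis[n [phi [y [phil phiy]]]].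
have [E [lamE Er En cr]] := form_exists f D D'.
have El := form_left_linear D D' alpha_f lamE.
case: (D) => lamP _ LP _ lamL; case: (D') => lam'P _ _ _ lam'L'.
have lam0 : exists h, lam h != 0 by exists L; rewrite lamL oner_eq0.
have lam'0 : exists h, lam' h != 0 by exists L'; rewrite lam'L' oner_eq0.
pose x i := \sw_(a, b <- L) (lam' (phi i (antipode H b)) : k) *: a.
have xP i h : lam (h * x i) = lam' (phi i h).
  rewrite (tlift_map (g := fun u => lam (h * u))); last by lin.
  rewrite -[h in RHS](dual_basisl lamP LP lamL).
  rewrite (tlift_map (g := fun u => lam' (phi i u))); last by lin.
  by apply: eq_sw => a b; rewrite -scalerAr !linearZ /= [_ *: _]mulrC.
have lamE1 h : lam' (E h) = lam h by have := lamE h 1; rewrite rmorph1 !mulr1.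
have phiE i h : phi i h = E (h * x i).
  apply/eqP; rewrite -subr_eq0; apply/eqP.
  apply: (right_cointegral_nondegr lam'P lam'0) => z.
  by rewrite mulrBr linearB /= -El -phil -xP lamE1 mulrA subrr.
exists E, n, x, y; split=> //; last by move=> gg;
  apply: (form_colinear_l D D' gg lamE).
split=> // h; first by rewrite -[RHS]phiy; apply: eq_bigr => i _; rewrite phiE.
(* The second identity is the transpose of the first: pair with [a], expand [a] through [phi] and
   [y], and use adjointness of [E]. *)
apply/eqP; rewrite -subr_eq0; apply/eqP.
apply: (right_cointegral_nondegr lamP lam0) => a.
rewrite mulrBr linearB /=; apply/eqP; rewrite subr_eq0; apply/eqP.
transitivity (lam' (E (a * h))); last exact: lamE1.
rewrite -[a in RHS]phiy mulr_suml mulr_sumr !linear_sum /=.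
apply: eq_bigr => i _.
by rewrite mulrA -lamE -mulrA El phiE.
Qed.

Variables (R : functor (rep_category H') (rep_category H))
  (aR : adjunction (res_functor f) R).
Variables (E : 'Hom(H, H')) (n : nat) (x y : 'I_n -> H).
Hypothesis Fs : frobenius_system E x y.

Fact lunit_cmk_subproof (V : rep H') (v : V) :
  forall z h, linfun (fun h => rep_act V (E h) v) (f z * h) =
    rep_act V z (linfun (fun h => rep_act V (E h) v) h).
Proof.
have l : linear (fun h => rep_act V (E h) v) by lin.
by move=> z h; rewrite !(linfunP l) (form_l (system_form Fs)) rep_actMv.
Qed.

Definition lunit_fun (V : rep H') (v : V) : rsp R V :=
  cmk aR (lunit_cmk_subproof v).

Lemma cev_lunit (V : rep H') (v : V) h : cev aR (lunit_fun v) h =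
    rep_act V (E h) v.
Proof. by rewrite cev_cmk linfunP //; lin. Qed.

Fact lunit_lin (V : rep H') : linear (@lunit_fun V).
Proof.
move=> c u v; apply: (cev_inj (aR := aR)) => h.
by rewrite cev_linl !cev_lunit linearP.
Qed.

Fact lunit_subproof (V : rep H') : forall h v,
  linfun (@lunit_fun V : V -> res_rep f (rsp R V)) (rep_act V h v) =
  rep_act (res_rep f (rsp R V)) h (linfun
    (@lunit_fun V : V -> res_rep f (rsp R V)) v).
Proof.
move=> h v; rewrite !(linfunP (@lunit_lin V)) res_rep_actE.
apply: (cev_inj (aR := aR)) => a.
by rewrite cev_act !cev_lunit (form_r (system_form Fs)) rep_actMv.
Qed.

Definition lunit (V : rep H') :
  rep_mor H' V (res_functor f (R V)) :=
  @mkhom _ _ V (res_rep f (rsp R V)) _ (@lunit_subproof V).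

Lemma lunitE V v : ap (lunit V) v = lunit_fun v.
Proof. exact: (linfunP (@lunit_lin V)). Qed.

Definition lcounit_fun (W : rep H) (r : rsp R (res_rep f W)) : W :=
  \sum_i rep_act W (x i) (cev aR r (y i)).

Fact lcounit_lin (W : rep H) : linear (@lcounit_fun W).
Proof. by rewrite /lcounit_fun /cev; lin. Qed.

(** Expand [y i * a] by [system_l], swap the sums, and collapse the sum over [i] by [system_r] at
    [a * x j]. *)
Lemma lcounit_subproof (W : rep H) : forall h r,
  linfun (@lcounit_fun W) (rep_act (rsp R (res_rep f W)) h r) =
  rep_act W h (linfun (@lcounit_fun W) r).
Proof.
move=> a r; rewrite !(linfunP (@lcounit_lin W)) /lcounit_fun.
transitivity (\sum_i \sum_j rep_act W (x i * f (E (y i * (a * x j))))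
  (cev aR r (y j))).
  apply: eq_bigr => i _; rewrite cev_act -[y i * a](system_l Fs).
  rewrite -(linfunP (cev_linr aR r)) linear_sum linear_sum /=;
    apply: eq_bigr => j _.
  by rewrite (linfunP (cev_linr aR r)) cev_res res_rep_actE rep_actMv mulrA.
rewrite exchange_big linear_sum /=; apply: eq_bigr => j _.
rewrite -sum_lfunE -linear_sum (system_r Fs).
exact: rep_actMv.
Qed.

Definition lcounit (W : rep H) :
  rep_mor H (R (res_functor f W)) W :=
  @mkhom _ _ (rsp R (res_rep f W)) W _ (@lcounit_subproof W).

Lemma lcounitE W r : ap (lcounit W) r = \sum_i rep_act W (x i) (cev aR r (y i)).
Proof. exact: (linfunP (@lcounit_lin W)). Qed.

(** The triangle identities are [system_l] and [system_r] at 1. It is kept transparent since its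
    unit and counit are unfolded when mates are computed. *)
Definition left_adjunction : adjunction R (res_functor f).
Proof.
refine (@Adjunction k _ _ R (res_functor f) lunit lcounit _ _ _ _).
- move=> V W g; apply: ap_ext => v; rewrite ap_comp [RHS]ap_comp !lunitE.
  rewrite [RHS](_ : _ = ap (fmap R g) (lunit_fun v)) //.
  apply: (cev_inj (aR := aR)) => h.
  by rewrite cev_fmap !cev_lunit ap_act.
- move=> V W g; apply: ap_ext => r; rewrite !ap_comp !lcounitE.
  rewrite linear_sum /=; apply: eq_bigr => i _.
  by rewrite cev_fmap ap_act.
- move=> V; apply: ap_ext => r; rewrite ap_comp ap_id lcounitE.
  apply: (cev_inj (aR := aR)) => h.
  rewrite -(linfunP (@cev_linl _ _ _ _ _ aR _ h)) linear_sum /=.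
  rewrite -[in RHS](system_l Fs h) -[RHS](linfunP (cev_linr aR r))
    linear_sum /=.
  apply: eq_bigr => i _.
  rewrite (linfunP (@cev_linl _ _ _ _ _ aR _ h)) (linfunP (cev_linr aR r)).
  by rewrite cev_act cev_fmap lunitE cev_lunit cev_res.
- move=> W; apply: ap_ext => w; rewrite ap_comp ap_id lunitE.
  rewrite [LHS](lcounitE (lunit_fun (w : res_rep f W))).
  transitivity (\sum_i rep_act W (x i * f (E (y i))) w).
    by apply: eq_bigr => i _; rewrite cev_lunit rep_actMv res_rep_actE.
  rewrite -sum_lfunE -linear_sum.
  under eq_bigr do rewrite -[y _]mulr1.
  by rewrite (system_r Fs) rep_act1v.
Defined.

Lemma system_frobenius : frobenius_functor (res_functor f).
Proof.
exists R, R; split; [exact: (inhabits left_adjunction) | exact: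
  (inhabits aR) |].
exact: (inhabits (id_nat_iso R)).
Qed.

End FrobeniusSystem.

(** * Frobenius forms from isomorphic adjoints *)

Section ComparisonForm.

Variables (k : fieldType) (H' H : hopf k) (f : bialg_map H' H).
Variables (L R : functor (rep_category H') (rep_category H)).
Variables (aL : adjunction L (res_functor f)).
Variables (aR : adjunction (res_functor f) R).
Variable theta : nat_iso L R.

Definition lsp (V : rep H') : rep H := L V.

Definition leta (V : rep H') (v : V) : lsp V := ap (adj_unit aL V) v.

Lemma leta_act (V : rep H') x (v : V) :
  leta (rep_act V x v) = rep_act (lsp V) (f x) (leta v).
Proof. by rewrite /leta ap_act res_rep_actE. Qed.

Lemma leta_nat (V W : rep H') (g : rep_mor H' V W) v :
  leta (ap g v) = ap (fmap L g) (leta v).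
Proof. by rewrite /leta -ap_comp (adj_unit_nat aL) ap_comp. Qed.

Lemma left_transposeK (V : rep H') (W : rep H)
    (g : rep_mor H' V (res_rep f W)) v :
  ap (adj_counit aL W) (ap (fmap L g) (leta v)) = ap g v.
Proof.
rewrite -leta_nat /leta.
have := adj_triangler aL W.
move/(congr1 (fun u : rep_mor H' (res_rep f W)
  (res_rep f W) => ap u (ap g v))); rewrite ap_id => {2}<-.
by rewrite ap_comp.
Qed.

(* Seen through [R V = Hom_H' (H, V)], the isomorphism [L V -> R V] is
   determined by the images of the elements of [V]; by naturality these are all
   governed by the single map [extracted_form]. *)
Definition comparison (V : rep H') (v : V) (h : H) : V :=
  cev aR (ap (theta V) (leta v) : rsp R V) h.

Lemma comparison_nat (V W : rep H') (g : rep_mor H' V W) v h :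
  comparison (ap g v) h = ap g (comparison v h).
Proof.
rewrite /comparison leta_nat -cev_fmap -ap_comp.
by rewrite (niso_nat theta) ap_comp.
Qed.

Lemma comparison_act (V : rep H') x (v : V) h :
  comparison (rep_act V x v) h = comparison v (h * f x).
Proof. by rewrite /comparison leta_act ap_act cev_act. Qed.

Definition extracted_form : 'Hom(H, H') :=
  linfun (comparison (V := regular_rep H') (1 : H')).

Lemma extracted_formE h : extracted_form h =
    comparison (V := regular_rep H') (1 : H') h.
Proof.
by rewrite linfunP //; exact: (@cev_linr _ _ _ _ _ aR (regular_rep H') _).
Qed.

(** Naturality along [a |-> a v] from the regular representation to [V] reduces the comparison at
    [v] to the one at 1. *)
Lemma comparisonE (V : rep H') (v : V) h :
  comparison v h = rep_act V (extracted_form h) v.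
Proof.
rewrite extracted_formE -[v in LHS]rep_act1v -orbit_morE comparison_nat.
exact: orbit_morE.
Qed.

Lemma extracted_frobenius_form : frobenius_form f extracted_form.
Proof.
split.
- move=> x h; rewrite !extracted_formE /comparison cev_res.
  exact: regular_repE.
- move=> x h.
  by rewrite extracted_formE -comparison_act regular_repE mulr1 comparisonE
    regular_repE.
move=> x Ex0.
(* As [theta] is injective, the vanishing of all [E (h * x)] means that [x] kills the unit element
   of [L H']. *)
have e0 : rep_act (lsp (regular_rep H')) x
  (leta (V := regular_rep H') (1 : H')) = 0.
  have thetaI : injective (ap (theta (regular_rep H'))).
    apply: (can_inj (g := ap (bwd (theta (regular_rep H'))))) => z.
    by rewrite -ap_comp fwdK ap_id.
  apply: thetaI; rewrite linear0 ap_act.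
  apply: (cev_inj (aR := aR)) => h; rewrite cev_act.
  have := Ex0 h; rewrite extracted_formE /comparison => ->.
  by rewrite /cev !linear0.
(* This is [f] seen as an [H']-morphism; its adjunct sends the unit element to 1 in [H], so
   [x = x * 1 = 0]. *)
pose g := orbit_mor (1 : res_rep f (regular_rep H)).
have := left_transposeK g (1 : H').
rewrite orbit_morE rep_act1v.
move/(congr1 (fun u => x * u)); rewrite mulr1 => <-.
by rewrite -regular_repE -!ap_act e0 !linear0.
Qed.

End ComparisonForm.

(** * Mates of the restriction functor and colinearity *)

Section Mates.

Variables (k : fieldType) (H' H : hopf k) (f : bialg_map H' H).
Local Notation F := (res_tensor_functor f).
Variables (R : functor (rep_monoidal H') (rep_monoidal H)).
Variable aR : adjunction F R.
Implicit Types (c : rep_monoidal H) (d : rep_monoidal H').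

(** These are the right-hand sides in [induced_right], stated for a bare right adjoint before it
    carries a bimodule structure. *)
Definition rmate_l c d : Defs.hom (c \ot R d) (R (F c \ot d)) :=
  fmap R ((idm (F c) \hot adj_counit aR d) \oc bwd (tf_mul F c (R d)))
    \oc adj_unit aR (c \ot R d).

Definition rmate_r d c : Defs.hom (R d \ot c) (R (d \ot F c)) :=
  fmap R ((adj_counit aR d \hot idm (F c)) \oc bwd (tf_mul F (R d) c))
    \oc adj_unit aR (R d \ot c).

Lemma rep_ot_pure (K : hopf k) (V W : rep K) h (v : V) (w : W) :
  rep_act (rep_ot V W) h (pure v w) =
  \sw_(a, b <- h) pure (rep_act V a v) (rep_act W b w).
Proof. exact: rep_ot_act_pure. Qed.

Lemma cev_rmate_l c d (t : rep_ot c (R d)) h :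
  cev aR (ap (rmate_l c d) t : rsp R (rep_ot (res_rep f c) d)) h =
  tmap \1%VF (ap (adj_counit aR d)) (rep_act (rep_ot c (R d)) h t).
Proof.
rewrite /rmate_l ap_comp cev_fmap cev_unit ap_comp.
by rewrite [ap (bwd _) _]id_lfunE.
Qed.

Lemma cev_rmate_r d c (t : rep_ot (R d) c) h :
  cev aR (ap (rmate_r d c) t : rsp R (rep_ot d (res_rep f c))) h =
  tmap (ap (adj_counit aR d)) \1%VF (rep_act (rep_ot (R d) c) h t).
Proof.
rewrite /rmate_r ap_comp cev_fmap cev_unit ap_comp.
by rewrite [ap (bwd _) _]id_lfunE.
Qed.

Lemma cev_rmate_l_pure c d (u : (c : rep H)) (r : rsp R d) h :
  cev aR (ap (rmate_l c d) (pure u r) : rsp R (rep_ot (res_rep f c) d)) h =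
  \sw_(a, b <- h) pure (rep_act c a u) (cev aR r b).
Proof.
rewrite cev_rmate_l rep_ot_pure tlift_map; last by lin.
by apply: eq_sw => a b; rewrite tmap_pure id_lfunE.
Qed.

Lemma cev_rmate_r_pure d c (u : (c : rep H)) (r : rsp R d) h :
  cev aR (ap (rmate_r d c) (pure r u) : rsp R (rep_ot d (res_rep f c))) h =
  \sw_(a, b <- h) pure (cev aR r a) (rep_act c b u).
Proof.
rewrite cev_rmate_r rep_ot_pure tlift_map; last by lin.
by apply: eq_sw => a b; rewrite tmap_pure id_lfunE.
Qed.

End Mates.

Section BimoduleComparison.

Variables (k : fieldType) (H' H : hopf k) (f : bialg_map H' H).
Local Notation F := (res_tensor_functor f).
Variables (L R : bimod_functor F) (aL : adjunction L F) (aR : adjunction F R).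
Hypotheses (indL : induced_left aL) (indR : induced_right aR).
Variable theta : bimod_iso L R.
Implicit Types (c : rep_monoidal H) (d : rep_monoidal H').

Let E := extracted_form aL aR theta.

(** As a mate, [bl L] sends the unit at [pure u v] to [u] tensor the unit at [v]; [bl R] is inverse
    to [rmate_l]; and [theta] intertwines the two. *)
Lemma comparison_pure_l c d (u : (c : rep H)) (v : (d : rep H')) h :
  comparison aL aR theta (V := rep_ot (res_rep f c) d) (pure u v) h =
  \sw_(a, b <- h) pure (rep_act c a u) (comparison aL aR theta (V := d) v b).
Proof.
rewrite -cev_rmate_l_pure /rmate_l.
rewrite /comparison; congr (cev aR _ h).
rewrite -(proj1 indR).
pose w : lsp L (rep_ot (res_rep f c) d) :=
  leta aL (V := rep_ot (res_rep f c) d) (pure u v).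
have blw : ap (bl L c d) w = pure u (leta aL v).
  rewrite (proj1 indL) ap_comp left_transposeK ap_comp tmap_pure id_lfunE.
  by congr (pure _ _); exact: id_lfunE.
have e : ap (bl R c d) (ap (theta (F c \ot d)) w) =
  pure u (ap (theta d) (leta aL v)).
  rewrite -ap_comp (biso_l theta) ap_comp blw.
  by apply: etrans (tmap_pure _ _ _ _) _; congr (pure _ _); exact: id_lfunE.
by rewrite -e -[RHS]ap_comp fwdK ap_id.
Qed.

Lemma comparison_pure_r c d (u : (c : rep H)) (v : (d : rep H')) h :
  comparison aL aR theta (V := rep_ot d (res_rep f c)) (pure v u) h =
  \sw_(a, b <- h) pure (comparison aL aR theta (V := d) v a) (rep_act c b u).
Proof.
rewrite -cev_rmate_r_pure /rmate_r.
rewrite /comparison; congr (cev aR _ h).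
rewrite -(proj2 indR).
pose w : lsp L (rep_ot d (res_rep f c)) :=
  leta aL (V := rep_ot d (res_rep f c)) (pure v u).
have brw : ap (br L d c) w = pure (leta aL v) u.
  rewrite (proj2 indL) ap_comp left_transposeK ap_comp tmap_pure id_lfunE.
  by congr (pure _ _); exact: id_lfunE.
have e : ap (br R d c) (ap (theta (d \ot F c)) w) =
  pure (ap (theta d) (leta aL v)) u.
  rewrite -ap_comp (biso_r theta) ap_comp brw.
  by apply: etrans (tmap_pure _ _ _ _) _; congr (pure _ _); exact: id_lfunE.
by rewrite -e -[RHS]ap_comp fwdK ap_id.
Qed.

(** Take both modules regular and [u = v = 1]: the comparison becomes the action of [E h] on
    [pure 1 1]. *)
Lemma extracted_colinear_l : colinear_l f E.
Proof.
move=> h; have := comparison_pure_l (c := regular_rep H)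
  (d := regular_rep H') 1 1 h.
rewrite comparisonE rep_ot_pure => e.
apply: etrans (etrans (esym e) _); apply: eq_sw => a b.
  by rewrite regular_repE mulr1 -extracted_formE.
by rewrite res_rep_actE !regular_repE !mulr1.
Qed.

Lemma extracted_colinear_r : colinear_r f E.
Proof.
move=> h; have := comparison_pure_r (c := regular_rep H)
  (d := regular_rep H') 1 1 h.
rewrite comparisonE rep_ot_pure => e.
apply: etrans (etrans (esym e) _); apply: eq_sw => a b.
  by rewrite regular_repE mulr1 -extracted_formE.
by rewrite res_rep_actE !regular_repE !mulr1.
Qed.

End BimoduleComparison.

(** * Bimodule structure on the right adjoint *)

Section MateIso.

Variables (k : fieldType) (H' H : hopf k) (f : bialg_map H' H).
Local Notation F := (res_tensor_functor f).
Variables (R : functor (rep_monoidal H') (rep_monoidal H)).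
Variable aR : adjunction F R.
Variables (E : 'Hom(H, H')) (n : nat) (x y : 'I_n -> H).
Hypothesis Fs : frobenius_system f E x y.
Hypotheses (cl : colinear_l f E) (cr : colinear_r f E).
Variable T : 'End(H).
Hypotheses (SK : cancel (antipode H) T) (TK : cancel T (antipode H)).
Implicit Types (c : rep_monoidal H) (d : rep_monoidal H').

Let aL : adjunction R F := left_adjunction aR Fs.

Definition lmate_l c d : Defs.hom (R (F c \ot d)) (c \ot R d) :=
  adj_counit aL (c \ot R d)
    \oc fmap R (tf_mul F c (R d) \oc (idm (F c) \hot adj_unit aL d)).

Definition lmate_r d c : Defs.hom (R (d \ot F c)) (R d \ot c) :=
  adj_counit aL (R d \ot c)
    \oc fmap R (tf_mul F (R d) c \oc (adj_unit aL d \hot idm (F c))).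

Lemma lmate_lE c d (r : rsp R (rep_ot (res_rep f c) d)) :
  ap (lmate_l c d) r = \sum_i rep_act (rep_ot c (R d)) (x i)
    (tmap \1%VF (ap (lunit aR Fs d)) (cev aR r (y i))).
Proof.
rewrite /lmate_l ap_comp [LHS]lcounitE; apply: eq_bigr => i _.
by rewrite cev_fmap ap_comp [ap (fwd _) _]id_lfunE.
Qed.

Lemma lmate_rE d c (r : rsp R (rep_ot d (res_rep f c))) :
  ap (lmate_r d c) r = \sum_i rep_act (rep_ot (R d) c) (x i)
    (tmap (ap (lunit aR Fs d)) \1%VF (cev aR r (y i))).
Proof.
rewrite /lmate_r ap_comp [LHS]lcounitE; apply: eq_bigr => i _.
by rewrite cev_fmap ap_comp [ap (fwd _) _]id_lfunE.
Qed.

(** This is where left colinearity enters: on [pure u v] the left side is [z1 u] tensor [E z2 v],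
    which colinearity identifies with the diagonal action of [E z]. *)
Lemma counit_lunit_l c d z (t : rep_ot (res_rep f c) d) :
  tmap \1%VF (ap (adj_counit aR d)) (rep_act (rep_ot c (R d)) z
    (tmap \1%VF (ap (lunit aR Fs d)) t)) =
      rep_act (rep_ot (res_rep f c) d) (E z) t.
Proof.
move: t; apply: tensor_lin_ext => [||u v]; [by lin | by lin |].
rewrite tmap_pure id_lfunE.
rewrite [X in tmap _ _ X]rep_ot_pure [RHS]rep_ot_pure tlift_map; last by lin.
transitivity (\sw_(a, b <- z) pure (rep_act (c : rep H) a u)
  (rep_act (d : rep H') (E b) v)).
  apply: eq_sw => a b; rewrite tmap_pure id_lfunE; congr (pure _ _).
  by rewrite lunitE -(cev_lunit aR Fs).
have := congr1 (tlift (fun p q => pure (rep_act (c : rep H) p u)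
  (rep_act (d : rep H') q v))) (cl z).
rewrite !tlift_lin => e.
transitivity (\sw_(a, b <- z) tlift
  (fun p q => pure (rep_act (c : rep H) p u) (rep_act (d : rep H') q v))
    (pure a (E b))).
  by apply: eq_sw => a b; rewrite tlift_pure //; bil.
rewrite e; apply: eq_sw => a b; rewrite tlift_pure; last by bil.
by rewrite res_rep_actE.
Qed.

Lemma counit_lunit_r d c z (t : rep_ot d (res_rep f c)) :
  tmap (ap (adj_counit aR d)) \1%VF (rep_act (rep_ot (R d) c) z
    (tmap (ap (lunit aR Fs d)) \1%VF t)) =
      rep_act (rep_ot d (res_rep f c)) (E z) t.
Proof.
move: t; apply: tensor_lin_ext => [||v u]; [by lin | by lin |].
rewrite tmap_pure id_lfunE.
rewrite [X in tmap _ _ X]rep_ot_pure [RHS]rep_ot_pure tlift_map; last by lin.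
transitivity (\sw_(a, b <- z) pure (rep_act (d : rep H') (E a) v)
  (rep_act (c : rep H) b u)).
  apply: eq_sw => a b; rewrite tmap_pure id_lfunE; congr (pure _ _).
  by rewrite lunitE -(cev_lunit aR Fs).
have := congr1 (tlift (fun q p => pure (rep_act (d : rep H') q v)
  (rep_act (c : rep H) p u))) (cr z).
rewrite !tlift_lin => e.
transitivity (\sw_(a, b <- z) tlift
  (fun q p => pure (rep_act (d : rep H') q v) (rep_act (c : rep H) p u))
    (pure (E a) b)).
  by apply: eq_sw => a b; rewrite tlift_pure //; bil.
rewrite e; apply: eq_sw => a b; rewrite tlift_pure; last by bil.
by rewrite res_rep_actE.
Qed.

(** Evaluated at [h], the composite is the sum of [E (h * x i)] acting on [cev r (y i)], which is
    [cev r h] by [system_l]. *)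
Lemma lmateK_l c d : cancel (ap (lmate_l c d)) (ap (rmate_l aR c d)).
Proof.
move=> r; apply: (cev_inj (aR := aR)) => h.
rewrite cev_rmate_l lmate_lE !linear_sum /=.
rewrite -[in RHS](system_l Fs h) -[RHS](linfunP (cev_linr aR r)) linear_sum /=.
apply: eq_bigr => i _; rewrite (linfunP (cev_linr aR r)) cev_res.
by rewrite -counit_lunit_l rep_actMv.
Qed.

Lemma lmateK_r d c : cancel (ap (lmate_r d c)) (ap (rmate_r aR d c)).
Proof.
move=> r; apply: (cev_inj (aR := aR)) => h.
rewrite cev_rmate_r lmate_rE !linear_sum /=.
rewrite -[in RHS](system_l Fs h) -[RHS](linfunP (cev_linr aR r)) linear_sum /=.
apply: eq_bigr => i _; rewrite (linfunP (cev_linr aR r)) cev_res.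
by rewrite -counit_lunit_r rep_actMv.
Qed.

Lemma cev_tensor_eq0l c d (t : rep_ot c (R d)) :
  (forall h, tlift (fun u r => pure u (cev aR (r : rsp R d) h)) t = 0) -> t = 0.
Proof.
move=> t0; apply: tensor_eq0r => xi; apply: (cev_inj (aR := aR)) => h.
rewrite /cev 2!linear0 -/(cev aR _ h).
rewrite (tlift_map (g := fun r : rsp R d => cev aR r h)); last exact: cev_linl.
transitivity (tlift (fun (u : c : rep H) (v : d : rep H') => (xi u : k) *: v)
  (tlift (fun u r => pure u (cev aR (r : rsp R d) h)) t));
    last by rewrite t0 linear0.
rewrite tlift_lin; congr (fun_of_lfun _ _); apply: eq_tlift => u r.
rewrite tlift_pure; last by bil.
by rewrite /cev !linearZ.
Qed.

Lemma cev_tensor_eq0r d c (t : rep_ot (R d) c) :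
  (forall h, tlift (fun r u => pure (cev aR (r : rsp R d) h) u) t = 0) -> t = 0.
Proof.
move=> t0; apply: tensor_eq0l => xi; apply: (cev_inj (aR := aR)) => h.
rewrite /cev 2!linear0 -/(cev aR _ h).
rewrite (tlift_map (g := fun r : rsp R d => cev aR r h)); last exact: cev_linl.
transitivity (tlift (fun (v : d : rep H') (u : c : rep H) => (xi u : k) *: v)
  (tlift (fun r u => pure (cev aR (r : rsp R d) h) u) t));
    last by rewrite t0 linear0.
rewrite tlift_lin; congr (fun_of_lfun _ _); apply: eq_tlift => r u.
rewrite tlift_pure; last by bil.
by rewrite /cev !linearZ.
Qed.

(** Acting by [S h1] on the first leg of [h2 u] tensor [r h3] recovers [u] tensor [r h]. *)
Lemma rmate_inj_l c d : injective (ap (rmate_l aR c d)).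
Proof.
apply: raddf_inj => t t0; apply: cev_tensor_eq0l => h.
transitivity (\sw_(a, b <- h) tmap (rep_act (c : rep H) (antipode H a)) \1%VF
    (cev aR (ap (rmate_l aR c d) t : rsp R (rep_ot (res_rep f c) d)) b));
      last first.
  rewrite t0 tliftE big1 // => i _; rewrite big1 // => j _.
  by rewrite /cev !linear0.
move: t {t0}; apply: tensor_lin_ext => [||u r];
  [by rewrite /cev; lin | by rewrite /cev; lin |].
rewrite tlift_pure; last by rewrite /cev; bil.
transitivity (\sw_(a, b <- h) \sw_(p, q <- b)
    pure (rep_act (c : rep H) (antipode H a * p) u) (cev aR (r : rsp R d) q));
      last first.
  apply: eq_sw => a b; rewrite cev_rmate_l_pure tlift_map; last by lin.
  by apply: eq_sw => p q; rewrite tmap_pure rep_actMv id_lfunE.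
apply: etrans (comul_assoc (E := fun a p q =>
    pure (rep_act (c : rep H) (antipode H a * p) u) (cev aR (r : rsp R d) q)) _
      _ _ _) => /=.
- symmetry.
  transitivity (\sw_(a, b <- h) (counit H a : k) *: pure u
    (cev aR (r : rsp R d) b)).
    apply: eq_sw => a b.
    rewrite (sw_antipodel (F := fun z => pure (rep_act (c : rep H) z u)
      (cev aR (r : rsp R d) b))); last by lin.
    by rewrite rep_act1v.
  rewrite (sw_counitl (F := fun b => pure u (cev aR (r : rsp R d) b))) //;
    rewrite /cev; lin.
- by lin.
- by lin.
- by rewrite /cev; lin.
Qed.

(** In the mirror image the later leg acts from the left, so the inverse antipode is used:
    [T h3 * h2] contracts to a counit. *)
Lemma rmate_inj_r d c : injective (ap (rmate_r aR d c)).
Proof.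
apply: raddf_inj => t t0; apply: cev_tensor_eq0r => h.
transitivity (\sw_(a, b <- h) tmap \1%VF (rep_act (c : rep H) (T b))
    (cev aR (ap (rmate_r aR d c) t : rsp R (rep_ot d (res_rep f c))) a));
      last first.
  rewrite t0 tliftE big1 // => i _; rewrite big1 // => j _.
  by rewrite /cev !linear0.
move: t {t0}; apply: tensor_lin_ext => [||r u];
  [by rewrite /cev; lin | by rewrite /cev; lin |].
rewrite tlift_pure; last by rewrite /cev; bil.
transitivity (\sw_(a, b <- h) \sw_(p, q <- a)
    pure (cev aR (r : rsp R d) p) (rep_act (c : rep H) (T b * q) u));
      last first.
  apply: eq_sw => a b; rewrite cev_rmate_r_pure tlift_map; last by lin.
  by apply: eq_sw => p q; rewrite tmap_pure rep_actMv id_lfunE.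
apply: etrans (esym (comul_assoc (E := fun p q b =>
    pure (cev aR (r : rsp R d) p) (rep_act (c : rep H) (T b * q) u)) _ _ _
      _)) => /=.
- symmetry.
  transitivity (\sw_(a, b <- h) (counit H b : k) *: pure
    (cev aR (r : rsp R d) a) u).
    apply: eq_sw => a b.
    rewrite (sw_antipodeVl SK TK (F := fun z => pure (cev aR (r : rsp R d) a)
      (rep_act (c : rep H) z u))); last by lin.
    by rewrite rep_act1v.
  rewrite (sw_counitr (F := fun a => pure (cev aR (r : rsp R d) a) u)) //;
    rewrite /cev; lin.
- by rewrite /cev; lin.
- by lin.
- by lin.
Qed.

End MateIso.

Section MonoidalPure.

Variables (k : fieldType) (H : hopf k).
Implicit Types (X Y Z : rep_monoidal H).

Lemma hot_pure X X' Y Y' (g : Defs.hom X X') (h : Defs.hom Y Y')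
    (u : (X : rep H)) (v : (Y : rep H)) :
  ap (g \hot h) (pure u v) = pure (ap g u) (ap h v).
Proof. exact: tmap_pure. Qed.

Lemma massoc_pure X Y Z (u : (X : rep H)) (v : (Y : rep H)) (w : (Z : rep H)) :
  ap (massoc X Y Z) (pure (pure u v : rep_ot X Y) w) =
    pure u (pure v w : rep_ot Y Z).
Proof. exact: tassoc_pure. Qed.

Lemma massocV_pure X Y Z (u : (X : rep H)) (v : (Y : rep H)) (w : (Z : rep H)) :
  ap (bwd (massoc X Y Z)) (pure u (pure v w : rep_ot Y Z)) =
    pure (pure u v : rep_ot X Y) w.
Proof. exact: tassocV_pure. Qed.

Lemma mlunit_pure X (a : k^o) (v : (X : rep H)) :
  ap (mlunit X) (pure (a : rep_unit H) v) = (a : k) *: v.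
Proof. exact: tlunit_pure. Qed.

Lemma mrunit_pure X (a : k^o) (v : (X : rep H)) :
  ap (mrunit X) (pure v (a : rep_unit H)) = (a : k) *: v.
Proof. exact: trunit_pure. Qed.

Lemma hot_cancel X X' Y Y' (g : Defs.hom X X') (g' : Defs.hom X' X)
   (h : Defs.hom Y Y') (h' : Defs.hom Y' Y) :
  cancel (ap g) (ap g') -> cancel (ap h) (ap h') ->
    cancel (ap (g \hot h)) (ap (g' \hot h')).
Proof.
move=> gK hK; apply: tensor_lin_ext => [||u v]; [by lin | by lin |].
by rewrite !hot_pure gK hK.
Qed.

Lemma id_cancel X : cancel (ap (idm X)) (ap (idm X)).
Proof. by move=> u; rewrite !ap_id. Qed.

End MonoidalPure.

Section RightMates.

Variables (k : fieldType) (H' H : hopf k) (f : bialg_map H' H).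
Local Notation F := (res_tensor_functor f).
Variables (R : functor (rep_monoidal H') (rep_monoidal H)).
Variable aR : adjunction F R.
Implicit Types (c : rep_monoidal H) (d : rep_monoidal H').

(** The bimodule axioms are first checked for right mates, which are explicit on pure tensors: units
    reduce to the counit axiom, associativity and the middle constraint to coassociativity. *)
Lemma rmate_nat_l c c' d d' (u : Defs.hom c c') (v : Defs.hom d d') t :
  ap (fmap R (fmap F u \hot v)) (ap (rmate_l aR c d) t) =
  ap (rmate_l aR c' d') (ap (u \hot fmap R v) t).
Proof.
move: t; apply: tensor_lin_ext => [||z r]; [by lin | by lin |].
rewrite hot_pure; apply: (cev_inj (aR := aR)) => h.
rewrite cev_rmate_l_pure cev_fmap cev_rmate_l_pure tlift_map; last by lin.
apply: eq_sw => a b; rewrite [LHS]hot_pure cev_fmap -ap_act.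
by [].
Qed.

Lemma rmate_nat_r c c' d d' (u : Defs.hom c c') (v : Defs.hom d d') t :
  ap (fmap R (v \hot fmap F u)) (ap (rmate_r aR d c) t) =
  ap (rmate_r aR d' c') (ap (fmap R v \hot u) t).
Proof.
move: t; apply: tensor_lin_ext => [||r z]; [by lin | by lin |].
rewrite hot_pure; apply: (cev_inj (aR := aR)) => h.
rewrite cev_rmate_r_pure cev_fmap cev_rmate_r_pure tlift_map; last by lin.
apply: eq_sw => a b; rewrite [LHS]hot_pure cev_fmap -ap_act.
by [].
Qed.

Lemma rmate_unit_l d t :
  ap (fmap R (tw_lunit F d)) (ap (rmate_l aR munit d) t) = ap (mlunit (R d)) t.
Proof.
move: t; apply: tensor_lin_ext => [||z r]; [by lin | by lin |].
rewrite mlunit_pure; apply: (cev_inj (aR := aR)) => h.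
rewrite cev_fmap cev_rmate_l_pure tlift_map; last by lin.
rewrite cevZ.
rewrite -(sw_counitl (F := fun b => (z : k) *: cev aR (r : rsp R d) b));
  last by rewrite /cev; lin.
apply: eq_sw => a b; rewrite /tw_lunit ap_comp hot_pure !ap_id.
by rewrite [LHS]mlunit_pure [rep_act _ _ _]rep_unit_actE scalerA.
Qed.

Lemma rmate_unit_r d t :
  ap (fmap R (tw_runit F d)) (ap (rmate_r aR d munit) t) = ap (mrunit (R d)) t.
Proof.
move: t; apply: tensor_lin_ext => [||r z]; [by lin | by lin |].
rewrite mrunit_pure; apply: (cev_inj (aR := aR)) => h.
rewrite cev_fmap cev_rmate_r_pure tlift_map; last by lin.
rewrite cevZ.
rewrite -(sw_counitr (F := fun b => (z : k) *: cev aR (r : rsp R d) b));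
  last by rewrite /cev; lin.
apply: eq_sw => a b; rewrite /tw_runit ap_comp hot_pure !ap_id.
by rewrite [LHS]mrunit_pure [rep_act _ _ _]rep_unit_actE scalerA.
Qed.

Lemma rmate_assoc_l c c' d t :
  ap (fmap R (tw_lassoc F c c' d)) (ap (rmate_l aR (c \ot c') d) t) =
  ap (rmate_l aR c (F c' \ot d)) (ap (idm c \hot rmate_l aR c' d)
    (ap (massoc c c' (R d)) t)).
Proof.
move: t; apply: tensor_lin_ext => [||z r]; [by lin | by lin |].
move: z; apply: tensor_lin_ext => [||u v]; [by lin | by lin |].
rewrite massoc_pure hot_pure ap_id; apply: (cev_inj (aR := aR)) => h.
rewrite cev_fmap !cev_rmate_l_pure tlift_map; last by lin.
transitivity (\sw_(a, b <- h) \sw_(p, q <- a) pure (rep_act (c : rep H) p u)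
  (pure (rep_act (c' : rep H) q v) (cev aR (r : rsp R d) b))).
  apply: eq_sw => a b; rewrite /tw_lassoc ap_comp hot_pure !ap_id.
  rewrite rep_ot_pure (tlift_map (g := fun z => ap (massoc (F c) (F c') d)
    (pure z (cev aR (r : rsp R d) b)))); last by lin.
  by apply: eq_sw => p q; apply: massoc_pure.
apply: etrans (comul_assoc _ _ _ _) _; try by rewrite /cev; lin.
apply: eq_sw => a b; rewrite cev_rmate_l_pure.
by rewrite (tlift_map (g := fun z => pure (rep_act (c : rep H) a u) z)) //; lin.
Qed.

Lemma rmate_assoc_r d c c' t :
  ap (fmap R (tw_rassoc F d c c')) (ap (rmate_r aR d (c \ot c')) t) =
  ap (rmate_r aR (d \ot F c) c') (ap (rmate_r aR d c \hot idm c')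
    (ap (bwd (massoc (R d) c c')) t)).
Proof.
move: t; apply: tensor_lin_ext => [||r z]; [by lin | by lin |].
move: z; apply: tensor_lin_ext => [||u v]; [by lin | by lin |].
rewrite massocV_pure hot_pure ap_id; apply: (cev_inj (aR := aR)) => h.
rewrite cev_fmap !cev_rmate_r_pure tlift_map; last by lin.
transitivity (\sw_(a, b <- h) \sw_(p, q <- b) pure
  (pure (cev aR (r : rsp R d) a) (rep_act (c : rep H) p u))
  (rep_act (c' : rep H) q v)).
  apply: eq_sw => a b; rewrite /tw_rassoc ap_comp hot_pure !ap_id.
  rewrite rep_ot_pure (tlift_map (g := fun z => ap (bwd (massoc d (F c) (F c')))
    (pure (cev aR (r : rsp R d) a) z))); last by lin.
  by apply: eq_sw => p q; apply: massocV_pure.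
apply: etrans (esym (comul_assoc _ _ _ _)) _; try by rewrite /cev; lin.
apply: eq_sw => a b; rewrite cev_rmate_r_pure.
by rewrite (tlift_map (g := fun z => pure z (rep_act (c' : rep H) b v))) //;
  lin.
Qed.

Lemma rmate_middle c d c' t :
  ap (fmap R (massoc (F c) d (F c')))
    (ap (rmate_r aR (F c \ot d) c') (ap (rmate_l aR c d \hot idm c') t)) =
  ap (rmate_l aR c (d \ot F c')) (ap (idm c \hot rmate_r aR d c')
    (ap (massoc c (R d) c') t)).
Proof.
move: t; apply: tensor_lin_ext => [||z v]; [by lin | by lin |].
move: z; apply: tensor_lin_ext => [||u r]; [by lin | by lin |].
rewrite massoc_pure !hot_pure !ap_id; apply: (cev_inj (aR := aR)) => h.
rewrite cev_fmap cev_rmate_r_pure cev_rmate_l_pure tlift_map; last by lin.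
transitivity (\sw_(a, b <- h) \sw_(p, q <- a) pure (rep_act (c : rep H) p u)
  (pure (cev aR (r : rsp R d) q) (rep_act (c' : rep H) b v))).
  apply: eq_sw => a b; rewrite cev_rmate_l_pure.
  rewrite (tlift_map (g := fun z => ap (massoc (F c) d (F c'))
    (pure z (rep_act (c' : rep H) b v)))); last by lin.
  by apply: eq_sw => p q; apply: massoc_pure.
apply: etrans (comul_assoc _ _ _ _) _; try by rewrite /cev; lin.
apply: eq_sw => a b; rewrite cev_rmate_r_pure.
by rewrite (tlift_map (g := fun z => pure (rep_act (c : rep H) a u) z)) //; lin.
Qed.

End RightMates.

Section Bimodule.

Variables (k : fieldType) (H' H : hopf k) (f : bialg_map H' H).
Local Notation F := (res_tensor_functor f).
Variables (R : functor (rep_monoidal H') (rep_monoidal H)).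
Variable aR : adjunction F R.
Variables (E : 'Hom(H, H')) (n : nat) (x y : 'I_n -> H).
Hypothesis Fs : frobenius_system f E x y.
Hypotheses (cl : colinear_l f E) (cr : colinear_r f E).
Variable T : 'End(H).
Hypotheses (SK : cancel (antipode H) T) (TK : cancel T (antipode H)).
Implicit Types (c : rep_monoidal H) (d : rep_monoidal H').

(** [rmate_l] is injective with right inverse [lmate_l], so the two are mutually inverse. *)
Lemma rmateK_l c d : cancel (ap (rmate_l aR c d)) (ap (lmate_l aR Fs c d)).
Proof. by move=> t; apply: (@rmate_inj_l _ _ _ _ _ aR); rewrite lmateK_l. Qed.

Lemma rmateK_r d c : cancel (ap (rmate_r aR d c)) (ap (lmate_r aR Fs d c)).
Proof.
by move=> t; apply: (rmate_inj_r (aR := aR) SK TK); rewrite lmateK_r.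
Qed.

Fact mate_l_fwdK c d : rmate_l aR c d \oc lmate_l aR Fs c d = idm _.
Proof. by apply: ap_ext => r; rewrite ap_comp lmateK_l // ap_id. Qed.

Fact mate_l_bwdK c d : lmate_l aR Fs c d \oc rmate_l aR c d = idm _.
Proof. by apply: ap_ext => r; rewrite ap_comp rmateK_l ap_id. Qed.

Fact mate_r_fwdK d c : rmate_r aR d c \oc lmate_r aR Fs d c = idm _.
Proof. by apply: ap_ext => r; rewrite ap_comp lmateK_r // ap_id. Qed.

Fact mate_r_bwdK d c : lmate_r aR Fs d c \oc rmate_r aR d c = idm _.
Proof. by apply: ap_ext => r; rewrite ap_comp rmateK_r ap_id. Qed.

Definition mate_iso_l c d : iso (R (F c \ot d)) (c \ot R d) :=
  Iso (mate_l_fwdK c d) (mate_l_bwdK c d).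

Definition mate_iso_r d c : iso (R (d \ot F c)) (R d \ot c) :=
  Iso (mate_r_fwdK d c) (mate_r_bwdK d c).

Lemma mate_iso_lK c d : cancel (ap (rmate_l aR c d)) (ap (mate_iso_l c d)).
Proof. exact: rmateK_l. Qed.

Lemma mate_iso_rK d c : cancel (ap (rmate_r aR d c)) (ap (mate_iso_r d c)).
Proof. exact: rmateK_r. Qed.

(** The constraints are left mates with right mates as stored inverses, so both induced structures
    hold by construction. Each axiom is transported by writing its argument as a right mate. *)
Definition coind_bimod : bimod_functor F.
Proof.
refine (@BimodFunctor k _ _ F R mate_iso_l mate_iso_r _ _ _ _ _ _ _).
- move=> c c' d d' u v; apply: ap_ext => r; rewrite -[r](lmateK_l aR Fs cl).
  move: (ap _ r) => t; rewrite [LHS]ap_comp [RHS]ap_comp mate_iso_lK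
    rmate_nat_l; exact: mate_iso_lK.
- move=> c c' d d' u v; apply: ap_ext => r; rewrite -[r](lmateK_r aR Fs cr).
  move: (ap _ r) => t; rewrite [LHS]ap_comp [RHS]ap_comp mate_iso_rK
    rmate_nat_r; exact: mate_iso_rK.
- move=> c c' d; apply: ap_ext => r; rewrite -[r](lmateK_l aR Fs cl).
  move: (ap _ r) => t; rewrite [LHS]ap_comp [LHS]ap_comp [RHS]ap_comp
    mate_iso_lK rmate_assoc_l mate_iso_lK.
  by apply: hot_cancel; [exact: id_cancel | exact: mate_iso_lK].
- move=> d; apply: ap_ext => r; rewrite -[r](lmateK_l aR Fs cl).
  move: (ap _ r) => t; rewrite [LHS]ap_comp mate_iso_lK;
    exact/esym/rmate_unit_l.
- move=> d c c'; apply: ap_ext => r; rewrite -[r](lmateK_r aR Fs cr).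
  move: (ap _ r) => t; rewrite [LHS]ap_comp [LHS]ap_comp [RHS]ap_comp
    mate_iso_rK rmate_assoc_r mate_iso_rK.
  by apply: hot_cancel; [exact: mate_iso_rK | exact: id_cancel].
- move=> d; apply: ap_ext => r; rewrite -[r](lmateK_r aR Fs cr).
  move: (ap _ r) => t; rewrite [LHS]ap_comp mate_iso_rK;
    exact/esym/rmate_unit_r.
move=> c d c'; apply: ap_ext => r; rewrite -[r](lmateK_r aR Fs cr).
move: (ap _ r) => s; rewrite [LHS]ap_comp [LHS]ap_comp [RHS]ap_comp [RHS]ap_comp
  mate_iso_rK.
have lK : cancel (ap (mate_iso_l c d \hot idm c'))
  (ap (rmate_l aR c d \hot idm c')).
  by apply: hot_cancel; [exact: lmateK_l | exact: id_cancel].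
have rK : cancel (ap (rmate_l aR c d \hot idm c'))
  (ap (mate_iso_l c d \hot idm c')).
  by apply: hot_cancel; [exact: mate_iso_lK | exact: id_cancel].
rewrite -[s]lK; move: (ap _ s) => t; rewrite rK rmate_middle mate_iso_lK.
by apply: hot_cancel; [exact: id_cancel | exact: mate_iso_rK].
Defined.

(** The same bimodule functor serves as left and right adjoint, so the identity is the required
    isomorphism. *)
Lemma system_tensor_frobenius : tensor_frobenius F.
Proof.
pose aL : adjunction coind_bimod F := left_adjunction aR Fs.
pose aR' : adjunction F coind_bimod := aR.
exists coind_bimod, coind_bimod, aL, aR'; split;
  [by split | by split | constructor].
apply: (@BimodIso _ _ _ _ coind_bimod coind_bimod (id_nat_iso coind_bimod)) =>
  [c d|d c].
  by rewrite compm1 mhom1 comp1m.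
by rewrite compm1 mhom1 comp1m.
Qed.

End Bimodule.

Theorem theorem5p5 (k : closedFieldType) (H' H : hopf k) (f : bialg_map H' H)
    (alphaH : {lrmorphism H -> k^o}) (alphaH' : {lrmorphism H' -> k^o})
    (gH : H) (gH' : H')
    (alphaHP : modular_function alphaH)
    (alphaH'P : modular_function alphaH')
    (gHP : distinguished_grouplike gH)
    (gH'P : distinguished_grouplike gH')
    (perfect_f : perfect_functor (res_functor f)) :
  ((frobenius_functor (res_functor f) <->
      (forall h : H', rel_modular f alphaH alphaH' h = counit H' h)) /\
   ((forall h : H', rel_modular f alphaH alphaH' h = counit H' h) <->
      (forall h : H', alphaH (f h) = alphaH' h)))
  /\
  ((tensor_frobenius (res_tensor_functor f) <->
      (forall h : H', rel_modular f alphaH alphaH' h = counit H' h) /\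
      f gH' = gH) /\
   ((forall h : H', rel_modular f alphaH alphaH' h = counit H' h) /\
      f gH' = gH <->
      (forall h : H', alphaH (f h) = alphaH' h) /\ f gH' = gH)).
Proof.
have [lam [L D]] := integral_pair_exists alphaHP gHP.
have [lam' [L' D']] := integral_pair_exists alphaH'P gH'P.
have chi := rel_modular_trivial f alphaH alphaH'.
have [R [aR] _] := perfect_f.
split; split; last 1 first.
- by split=> -[/chi ? ?].
- split=> [[L0 [R0 [[aL0] [aR0] [theta]]]]|/chi alpha_f].
    apply/chi; exact: (form_modular D D'
      (extracted_frobenius_form aL0 aR0 theta)).
  have [E [n [x [y [Fs _ _]]]]] := frobenius_system_exists D D' alpha_f
    perfect_f.
  exact: (system_frobenius aR Fs).
- exact: chi.
split=> [[L0 [R0 [aL0 [aR0 [indL indR [theta]]]]]]|[/chi alpha_f gg]].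
  have Ef := extracted_frobenius_form aL0 aR0 theta.
  split; first by apply/chi; exact: (form_modular D D' Ef).
  apply: (form_grouplike D D' Ef).
    exact: (extracted_colinear_l indL indR theta).
  exact: (extracted_colinear_r indL indR theta).
have [E [n [x [y [Fs cr /(_ gg) cl]]]]] :=
  frobenius_system_exists D D' alpha_f perfect_f.
case: (D) => lamP _ LP _ lamL.
(* The inverse antipode of [H] is what makes the right-hand mates injective. *)
have [T [SK TK]] := antipode_bij lamP LP lamL.
exact: (@system_tensor_frobenius _ _ _ _ R aR _ _ _ _ Fs cl cr T SK TK).
Qed.
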